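(* Let $\Omega\subset\mathbb{R}^n$ be a $C^2$ bounded domain, and let $g$ be a continuous function on $\overline{\Omega}$. Then the Navier boundary value problem $$\begin{cases}(\Delta v)^3|D(\Delta v)|^2=0 & \text{in }\Omega,\\ v=g & \text{on }\partial\Omega,\\ \Delta v=0 & \text{on }\partial\Omega\end{cases}$$ admits a unique classical solution $v$, and $v$ is precisely the solution to the Dirichlet problem $\Delta v=0$ in $\Omega$, $v=g$ on $\partial\Omega$.
   Context: $D$ denotes the gradient. A classical solution is a function $v\in C^3(\Omega)\cap C(\overline{\Omega})$ satisfying the equation pointwise in $\Omega$, with $v=g$ on $\partial\Omega$, and such that $\Delta v$ extends continuously to $\overline\Omega$ with value $0$ on $\partial\Omega$. *)

(* Defs.v *)
From mathcomp Require Import all_boot all_order all_algebra.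
From mathcomp Require Import all_classical all_reals all_analysis.

Set Implicit Arguments.
Unset Strict Implicit.
Unset Printing Implicit Defensive.

Import Order.TTheory GRing.Theory Num.Theory.
Import numFieldNormedType.Exports.

Local Open Scope classical_set_scope.
Local Open Scope ring_scope.

(* Functions on a set are represented by total functions on R^n. Derivatives
   are only ever used at points of an open set, so they do not depend on the
   values outside of it. *)

Definition partial (R : realType) (n : nat) (i : 'I_n) (f : 'rV[R]_n -> R)
    (x : 'rV[R]_n) : R :=
  'D_(delta_mx 0 i) f x.

Definition gradient (R : realType) (n : nat) (f : 'rV[R]_n -> R)
    (x : 'rV[R]_n) : 'rV[R]_n :=
  \row_i partial i f x.

Definition laplacian (R : realType) (n : nat) (f : 'rV[R]_n -> R)
    (x : 'rV[R]_n) : R :=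
  \sum_(i < n) partial i (partial i f) x.

(* The norm `|x| of the library on row vectors is the sup norm. *)
Definition euclidean_norm (R : realType) (n : nat) (x : 'rV[R]_n) : R :=
  Num.sqrt (\sum_(i < n) x 0 i ^+ 2).

(* f is of class C^k on the open set U: its partial derivatives of order at
   most k exist and are continuous on U. *)
Fixpoint Ck (R : realType) (n : nat) (k : nat) (U : set 'rV[R]_n)
    (f : 'rV[R]_n -> R) : Prop :=
  (forall x, U x -> {for x, continuous f}) /\
  if k is k'.+1 then
    forall i : 'I_n,
      (forall x, U x -> derivable f x (delta_mx 0 i)) /\ Ck k' U (partial i f)
  else True.

Definition boundary (T : topologicalType) (A : set T) : set T :=
  closure A `\` interior A.

Definition domain (R : realType) (n : nat) (Omega : set 'rV[R]_n) : Prop :=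
  [/\ open Omega, connected Omega & Omega !=set0].

(* Near each boundary point, up to relabeling and reorienting the coordinate
   axes, Omega is the strict epigraph of a C^2 function of n - 1 variables:
   k selects the vertical axis, s its orientation, and col' k x is x with its
   k-th coordinate removed. *)
Definition C2_boundary (R : realType) (n : nat) (Omega : set 'rV[R]_n) : Prop :=
  forall x0, boundary Omega x0 ->
  exists (k : 'I_n) (s : bool) (gamma : 'rV[R]_n.-1 -> R),
    Ck 2 setT gamma /\
    \forall x \near x0, Omega x <-> gamma (col' k x) < (-1) ^+ s * x 0 k.

Definition dirichlet_solution (R : realType) (n : nat) (Omega : set 'rV[R]_n)
    (g v : 'rV[R]_n -> R) : Prop :=
  [/\ Ck 2 Omega v,
      {within closure Omega, continuous v},
      forall x, Omega x -> laplacian v x = 0 &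
      forall x, boundary Omega x -> v x = g x].

Definition navier_solution (R : realType) (n : nat) (Omega : set 'rV[R]_n)
    (g v : 'rV[R]_n -> R) : Prop :=
  [/\ Ck 3 Omega v,
      {within closure Omega, continuous v},
      forall x, Omega x ->
        laplacian v x ^+ 3 * euclidean_norm (gradient (laplacian v) x) ^+ 2 = 0,
      forall x, boundary Omega x -> v x = g x &
      exists w : 'rV[R]_n -> R,
        [/\ {within closure Omega, continuous w},
            {in Omega, w =1 laplacian v} &
            forall x, boundary Omega x -> w x = 0]].

(* Main.v *)
Require Import Defs.
From mathcomp Require Import all_boot all_order all_algebra.
From mathcomp Require Import all_classical all_reals all_analysis.
From mathcomp Require Import ring lra.


(** The nonlinear equation says that, at each point of the domain, the Laplacian
    [u] of a solution vanishes or has zero gradient; hence all first derivatives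
    of [u ^+ 2] vanish, [u ^+ 2] is constant along every segment of the domain,
    and a segment prolonged up to the boundary, where [u] extends by [0], shows
    that [u = 0] ([navier_laplacian_eq0]).  So Navier solutions are the same as
    Dirichlet solutions of class C^3, and the theorem amounts to the
    well-posedness of the Dirichlet problem for the Laplace equation.

    Uniqueness is the maximum principle ([dirichlet_le]).  Existence is proved by
    finite differences, following Courant, Friedrichs and Lewy: functions that are
    harmonic for the discrete Laplacian [dlap h] of step [h] are built, estimated
    uniformly in [h], and then [h] tends to [0].  All comparison functions are
    quadratic polynomials, on which [dlap h] is exact, so that no discretization
    error ever appears.

    - The discrete Dirichlet problem is solved by monotone iteration of the mean
      over neighbours ([discrete_dirichlet]).  The discrete maximum principle
      [dlap_max_principle] gives all estimates.

    - Interior estimates come from reflections: the difference between a harmonic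
      function and its mirror image is odd, and a quadratic barrier on half a cube
      bounds it near the mirror ([discrete_gradient_le]).  A difference quotient of
      a discrete harmonic function is again discrete harmonic, so the bound
      iterates to difference quotients of any order ([harmonic_family_fdiff]).

    - Boundary estimates come from the C^2 regularity: near a boundary point the
      domain lies on one side of a paraboloid ([boundary_paraboloid]), which yields
      a quadratic superharmonic barrier ([quadratic_barrier]) and continuity up to
      the boundary, uniformly in [h] ([discrete_boundary]).

    - The limit is taken pointwise along an ultrafilter of steps tending to [0]
      ([ulimit]), which replaces the extraction of subsequences.  A discrete
      second-order Taylor bound passes to the limit and shows that the derivatives
      of the limit are the limits of the difference quotients ([is_derive_ulimit]).
      Hence the limit is smooth ([Ck_ulimit]) and harmonic ([laplacian_ulimit]). *)

Import Order.TTheory GRing.Theory Num.Theory.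
Import numFieldNormedType.Exports.

Local Open Scope classical_set_scope.
Local Open Scope ring_scope.

Set Implicit Arguments.
Unset Strict Implicit.
Unset Printing Implicit Defensive.

(** * Discrete Laplacian and discrete maximum principle *)

Section DiscreteLaplacian.
Context {R : realType} {n : nat}.
Implicit Types (x y z c : 'rV[R]_n) (u w : 'rV[R]_n -> R) (a : 'I_n -> R).
Implicit Types (h t k d M : R) (i j : 'I_n).

(** Unnormalized: [dlap h u x / h ^+ 2] approximates the
    Laplacian of [u] at [x]. *)
Definition dlap h u x : R :=
  \sum_(i < n) (u (x + h *: delta_mx 0 i) + u (x - h *: delta_mx 0 i)
                - 2 * u x).

(** The Euclidean square norm; the norm [`|x|] of row vectors is the sup norm. *)
Definition sqnorm x : R := \sum_(i < n) x 0 i ^+ 2.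

Definition dotp a x : R := \sum_(i < n) a i * x 0 i.

Lemma shiftE x t i j :
  (x + t *: delta_mx 0 i) 0 j = x 0 j + t * (j == i)%:R.
Proof. by rewrite !mxE /=. Qed.

Lemma norm_rV_le x k : 0 <= k -> (forall j, `|x 0 j| <= k) -> `|x| <= k.
Proof.
move=> k0 xk; rewrite [leLHS]/Num.norm/= mx_normrE; apply/bigmax_leP; split=> //.
by move=> [i j] _ /=; rewrite (ord1 i).
Qed.

Lemma norm_rV_coord x j : `|x 0 j| <= `|x|.
Proof.
rewrite [leRHS]/Num.norm/= mx_normrE.
exact: (le_bigmax _ (fun ij : 'I_1 * 'I_n => `|x ij.1 ij.2|) (0, j)).
Qed.

Lemma norm_scale_delta t i : `|t *: delta_mx 0 i : 'rV[R]_n| = `|t|.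
Proof.
apply/le_anti/andP; split.
  apply: norm_rV_le => // j; rewrite !mxE /= normrM.
  by case: (j == i); rewrite ?normr1 ?normr0 ?mulr1 ?mulr0.
have := norm_rV_coord (t *: delta_mx 0 i) i.
by rewrite !mxE !eqxx mulr1.
Qed.

Lemma norm_shift_le x t i : `|x + t *: delta_mx 0 i| <= `|x| + `|t|.
Proof. by rewrite (le_trans (ler_normD _ _))// norm_scale_delta. Qed.

Lemma sqnorm_ge0 x : 0 <= sqnorm x.
Proof. by apply: sumr_ge0 => i _; exact: sqr_ge0. Qed.

Lemma sqnorm_le x k : `|x| <= k -> sqnorm x <= n%:R * k ^+ 2.
Proof.
move=> xk; have -> : n%:R * k ^+ 2 = \sum_(i < n) k ^+ 2.
  by rewrite sumr_const card_ord mulr_natl.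
apply: ler_sum => i _; rewrite -real_normK ?num_real//.
by rewrite lerXn2r ?nnegrE ?(le_trans _ xk)// (le_trans (norm_rV_coord x i)).
Qed.

Lemma le_sqnorm x : `|x| ^+ 2 <= sqnorm x.
Proof.
have [x0|x0] := eqVneq `|x| 0; first by rewrite x0 expr0n/= sqnorm_ge0.
have [[i j] /= xE] := mx_norm_neq0 x0.
rewrite (ord1 i) in xE; rewrite [`|x|]xE /sqnorm (bigD1 j)//=.
by rewrite real_normK ?num_real// lerDl; apply: sumr_ge0 => ? _; exact: sqr_ge0.
Qed.

Lemma sqnorm_shift x t i :
  sqnorm (x + t *: delta_mx 0 i) = sqnorm x + 2 * t * x 0 i + t ^+ 2.
Proof.
rewrite /sqnorm (bigD1 i)//= [in RHS](bigD1 i)//= shiftE eqxx mulr1.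
rewrite (eq_bigr (fun j => x 0 j ^+ 2)); last first.
  by move=> j /negPf ji; rewrite shiftE ji mulr0 addr0.
ring.
Qed.

Lemma dotp_shift a x t i : dotp a (x + t *: delta_mx 0 i) = dotp a x + t * a i.
Proof.
rewrite /dotp (bigD1 i)//= [in RHS](bigD1 i)//= shiftE eqxx mulr1.
rewrite (eq_bigr (fun j => a j * x 0 j)); last first.
  by move=> j /negPf ji; rewrite shiftE ji mulr0 addr0.
ring.
Qed.

Lemma dlapD h u w x : dlap h (fun y => u y + w y) x = dlap h u x + dlap h w x.
Proof. by rewrite -big_split; apply: eq_bigr => i _ /=; ring. Qed.

Lemma dlapZ h k u x : dlap h (fun y => k * u y) x = k * dlap h u x.
Proof. by rewrite mulr_sumr; apply: eq_bigr => i _ /=; ring. Qed.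

Lemma dlapN h u x : dlap h (fun y => - u y) x = - dlap h u x.
Proof. by rewrite -sumrN; apply: eq_bigr => i _ /=; ring. Qed.

Lemma dlapB h u w x : dlap h (fun y => u y - w y) x = dlap h u x - dlap h w x.
Proof. by rewrite dlapD dlapN. Qed.

Lemma dlap_cst h k x : dlap h (fun=> k) x = 0.
Proof. by rewrite /dlap big1// => i _; ring. Qed.

Lemma dlap_shift h u c x : dlap h (fun y => u (y + c)) x = dlap h u (x + c).
Proof. by apply: eq_bigr => i _; rewrite !(addrAC x _ c). Qed.

Lemma dlap_sqnorm h x : dlap h sqnorm x = 2 * n%:R * h ^+ 2.
Proof.
rewrite /dlap (eq_bigr (fun=> 2 * h ^+ 2)).
  by rewrite sumr_const card_ord -mulr_natl; ring.
by move=> i _; rewrite -scaleNr !sqnorm_shift; ring.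
Qed.

Lemma dlap_dotp h a x : dlap h (dotp a) x = 0.
Proof. by rewrite /dlap big1// => i _; rewrite -scaleNr !dotp_shift; ring. Qed.

Lemma dlap_dotp_sq h a x :
  dlap h (fun y => dotp a y ^+ 2) x = 2 * h ^+ 2 * \sum_(i < n) a i ^+ 2.
Proof.
rewrite mulr_sumr; apply: eq_bigr => i _.
by rewrite -scaleNr !dotp_shift; ring.
Qed.

Lemma dlap_le h u w x : w x = u x ->
  (forall i, u (x + h *: delta_mx 0 i) <= w (x + h *: delta_mx 0 i)) ->
  (forall i, u (x - h *: delta_mx 0 i) <= w (x - h *: delta_mx 0 i)) ->
  dlap h u x <= dlap h w x.
Proof.
by move=> wx uw1 uw2; apply: ler_sum => i _; rewrite wx lerB// lerD.
Qed.

(** As [u] need not attain its supremum, it is perturbed by a small multiple of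
    [sqnorm]: the discrete Laplacian of the sum is bounded below by a positive
    constant, so a point where the sum is almost maximal would have a neighbour
    exceeding the supremum.  Assuming the inequality only where [u] is positive
    allows [u] to be the positive part of a function cut off to [0] outside of a
    region. *)
Lemma dlap_max_principle h u : (0 < n)%N -> 0 < h ->
  (exists M, forall x, u x <= M) ->
  (exists d, forall x, 0 < u x -> `|x| <= d) ->
  (forall x, 0 < u x -> 0 <= dlap h u x) ->
  forall x, u x <= 0.
Proof.
move=> n0 h0 [M uM] [d ud] lapu x0; rewrite leNgt; apply/negP => ux0.
set Q := n%:R * (d + h) ^+ 2.
have Q0 : 0 <= Q by rewrite mulr_ge0// sqr_ge0.
(* The perturbation is at most [e * Q <= u x0] on the points involved. *)
set e := u x0 / (Q + 1).
have e0 : 0 < e by rewrite divr_gt0// ltr_wpDl.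
have eQ : e * Q <= u x0.
  by rewrite /e -mulrA ler_piMr ?(ltW ux0)// mulrC ler_pdivrMr; lra.
set G := fun y => u y + e * sqnorm y.
set A := [set G y | y in [set y | 0 < u y]].
have d0 : 0 <= d by exact: le_trans (ud _ ux0).
have supA : has_sup A.
  split; first by exists (G x0), x0.
  exists (M + e * Q) => _ [y /= uy <-]; rewrite lerD// ler_pM2l//.
  by apply: sqnorm_le; rewrite (le_trans (ud _ uy))// lerDl ltW.
have Gsup y : 0 < u y -> G y <= sup A.
  by move=> uy; apply: ub_le_sup; [exact: supA.2|exists y].
have supx0 : u x0 <= sup A.
  by rewrite (le_trans _ (Gsup _ ux0))// lerDl mulr_ge0 ?sqnorm_ge0 ?ltW.
have eh : 0 < e * h ^+ 2 by rewrite mulr_gt0// exprn_gt0.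
have [_ [x /= ux <-] Gx] := sup_adherent eh supA.
have nb y : `|y| <= d + h -> G y <= sup A.
  move=> yd; have [/Gsup//|uy] := ltP 0 (u y).
  rewrite (le_trans _ supx0)// (le_trans _ eQ)// -[leRHS]add0r lerD//.
  by rewrite ler_pM2l// sqnorm_le.
have le1 : dlap h G x <= \sum_(i < n) (2 * (sup A - G x)).
  apply: ler_sum => i _.
  have xd : `|x| + `|h| <= d + h by rewrite gtr0_norm// lerD2r ud.
  have := nb _ (le_trans (norm_shift_le x h i) xd).
  have := nb _ (le_trans (norm_shift_le x (- h) i) _).
  by rewrite normrN scaleNr => /(_ xd); lra.
have ge1 : 2 * n%:R * (e * h ^+ 2) <= dlap h G x.
  rewrite /G (dlapD _ u (fun y => e * sqnorm y)) dlapZ dlap_sqnorm.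
  have := lapu _ ux; lra.
have := le_trans ge1 le1.
rewrite sumr_const card_ord -[leRHS]mulr_natl => le2.
have n0' : 0 < n%:R :> R by rewrite ltr0n.
have Gx' : 0 < G x - (sup A - e * h ^+ 2) by rewrite subr_gt0.
have := mulr_gt0 n0' Gx'.
move: le2; lra.
Qed.

End DiscreteLaplacian.

(** * Discrete Dirichlet problem *)

Lemma cvg_fin_sum {R : realType} {T I : Type} {F : set_system T} {FF : Filter F}
    (r : seq I) (P : pred I) (f : I -> T -> R) (l : I -> R) :
  (forall i, P i -> f i t @[t --> F] --> l i) ->
  \sum_(i <- r | P i) f i t @[t --> F] --> \sum_(i <- r | P i) l i.
Proof.
move=> fl; elim: r => [|i r IH].
  under eq_cvg do rewrite big_nil.
  by rewrite big_nil; exact: cvg_cst.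
under eq_cvg do rewrite big_cons.
rewrite big_cons; case: ifPn => // Pi.
by apply: cvgD => //; exact: fl.
Qed.

Lemma dlap_mean {R : realType} {n : nat} (h : R) (u : 'rV[R]_n -> R) x :
  (0 < n)%N -> dlap h u x = 0 <->
  u x = (2 * n%:R)^-1 * \sum_(i < n) (u (x + h *: delta_mx 0 i)
                                      + u (x - h *: delta_mx 0 i)).
Proof.
move=> n0; have n0' : 2 * n%:R != 0 :> R by rewrite mulf_neq0// pnatr_eq0 -lt0n.
rewrite /dlap sumrB sumr_const card_ord -[_ *+ n]mulr_natr.
have -> : 2 * u x * n%:R = (2 * n%:R) * u x by ring.
split=> [/subr0_eq ->|{1}->]; first by rewrite mulKf.
by rewrite mulVKf// subrr.
Qed.

(** Start from the constant [- M] on [A] and iterate the mean over neighbours; the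
    mean being monotone, the iterates increase, and their limit is a fixed
    point. *)
Lemma discrete_dirichlet {R : realType} {n : nat} (h : R) (A : set 'rV[R]_n)
    (g : 'rV[R]_n -> R) (M : R) : (0 < n)%N -> (forall x, `|g x| <= M) ->
  exists u : 'rV[R]_n -> R, [/\ forall x, `|u x| <= M,
    forall x, A x -> dlap h u x = 0 & forall x, ~ A x -> u x = g x].
Proof.
move=> n0 gM.
pose m f (x : 'rV[R]_n) := (2 * n%:R)^-1 *
  \sum_(i < n) (f (x + h *: delta_mx 0 i) + f (x - h *: delta_mx 0 i)) : R.
pose T f x := if `[< A x >] then m f x else g x.
pose f k := iter k T (fun x => if `[< A x >] then - M else g x).
have n0' : 0 < 2 * n%:R :> R by rewrite mulr_gt0// ltr0n.
have mono f1 f2 : (forall x, f1 x <= f2 x) -> forall x, T f1 x <= T f2 x.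
  move=> f12 x; rewrite /T; case: ifP => // _.
  by rewrite ler_pM2l ?invr_gt0//; apply: ler_sum => i _; rewrite lerD.
have mcst c x : m (fun=> c) x = c.
  rewrite /m sumr_const card_ord -(mulr_natl (c + c)).
  by rewrite (_ : n%:R * (c + c) = 2 * n%:R * c) ?mulKf ?gt_eqF//; ring.
have fM k x : f k x <= M.
  elim: k x => [|k IH] x /=.
    case: ifP => _; last by have := gM x; rewrite ler_norml => /andP[].
    by rewrite ge0_cp// (le_trans _ (gM x)).
  apply: (le_trans (mono _ _ IH x)); rewrite /T mcst.
  by case: ifP => // _; have := gM x; rewrite ler_norml => /andP[].
have fM' k x : - M <= f k x.
  elim: k x => [|k IH] x /=.
    by case: ifP => // _; have := gM x; rewrite ler_norml => /andP[].
  apply: (le_trans _ (mono _ _ IH x)); rewrite /T mcst.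
  by case: ifP => // _; have := gM x; rewrite ler_norml => /andP[].
have fS k x : f k x <= f k.+1 x.
  elim: k x => [|k IH] x; last exact: mono.
  rewrite [leLHS]/f /=; case: ifPn => Ax; first exact: fM' 1%N x.
  by rewrite /f /= /T (negPf Ax).
have fmono x : nondecreasing_seq (f ^~ x).
  by apply/nondecreasing_seqP => k; exact: fS.
have fcvg x : cvgn (f ^~ x).
  by apply: nondecreasing_is_cvgn => //; exists M => _ [k _ <-].
exists (fun x => limn (f ^~ x)); split => [x|x Ax|x Ax].
- rewrite ler_norml; apply/andP; split.
    by apply: limr_ge => //; apply: nearW.
  by apply: limr_le => //; apply: nearW.
- apply/dlap_mean => //; apply: cvg_lim => //.
  rewrite -(cvg_shiftS (f ^~ x)).
  rewrite (_ : [sequence f k.+1 x]_k = fun k => m (f k) x); last first.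
    by apply/funext => k; rewrite /f /= {1}/T asboolT.
  apply: cvgMl_tmp; apply: cvg_fin_sum => i _.
  by apply: cvgD; exact: fcvg.
- apply: cvg_lim => //; rewrite (_ : f ^~ x = fun=> g x); first exact: cvg_cst.
  by apply/funext => -[|k]; rewrite /f /= ?/T asboolF.
Qed.

(** * Interior gradient estimate *)

Section GradientEstimate.
Context {R : realType} {n : nat}.
Implicit Types (x y z : 'rV[R]_n) (u : 'rV[R]_n -> R).
Implicit Types (h d M : R) (i j : 'I_n).

Definition reflection i z : 'rV[R]_n := z - (2 * z 0 i) *: delta_mx 0 i.

Lemma reflectionE i z j :
  reflection i z 0 j = if j == i then - z 0 j else z 0 j.
Proof.
rewrite /reflection !mxE /=; case: (j =P i) => [->|_]; rewrite /=.
  by ring.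
by rewrite mulr0 subr0.
Qed.

Lemma reflectionK i : involutive (reflection i).
Proof.
move=> z; apply/rowP => j; rewrite !reflectionE.
by case: (j == i); rewrite ?opprK.
Qed.

Lemma norm_reflection i z : `|reflection i z| <= `|z|.
Proof.
apply: norm_rV_le => // j; rewrite reflectionE.
by case: (j == i); rewrite ?normrN norm_rV_coord.
Qed.

Lemma sqnorm_reflection i z : sqnorm (reflection i z) = sqnorm z.
Proof.
apply: eq_bigr => j _; rewrite reflectionE.
by case: (j == i); rewrite ?sqrrN.
Qed.

(** Reflecting permutes the neighbours of a point, so [dlap] commutes with the
    reflection. *)
Lemma reflection_shift i z (t : R) j :
  reflection i (z + t *: delta_mx 0 j) =
  reflection i z + (if j == i then - t else t) *: delta_mx 0 j.
Proof.
apply/rowP => k; rewrite reflectionE !shiftE reflectionE.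
have [->|ki] := eqVneq k i.
  by rewrite [i == j]eq_sym; case: (j == i); rewrite ?mulr0 ?addr0 ?opprD ?mulNr.
by have [->|] := eqVneq j i; rewrite ?(negPf ki) ?mulr0.
Qed.

Lemma dlap_reflection h u i z :
  dlap h (fun y => u (reflection i y)) z = dlap h u (reflection i z).
Proof.
apply: eq_bigr => j _ /=; rewrite -(scaleNr h) !reflection_shift.
by case: (j == i) => //; rewrite opprK; congr (_ - _); exact: addrC.
Qed.

Lemma dotp_coord i z : dotp (fun j => (j == i)%:R) z = z 0 i.
Proof.
rewrite /dotp (bigD1 i)//= eqxx mul1r big1 ?addr0// => j /negPf ->.
by rewrite mul0r.
Qed.

Lemma dlap_coord h i x : dlap h (fun y => y 0 i) x = 0.
Proof.
by rewrite -[RHS](dlap_dotp h (fun j => (j == i)%:R) x);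
   congr dlap; apply/funext => y; rewrite dotp_coord.
Qed.

Lemma dlap_coord_sq h i x : dlap h (fun y => y 0 i ^+ 2) x = 2 * h ^+ 2.
Proof.
transitivity (dlap h (fun y => dotp (fun j => (j == i)%:R) y ^+ 2) x).
  by congr dlap; apply/funext => y; rewrite dotp_coord.
rewrite dlap_dotp_sq (bigD1 i)//= eqxx big1 ?addr0 ?expr1n ?mulr1//.
by move=> j /negPf ->; rewrite expr0n.
Qed.

(** With [phi] the difference between [u] and its mirror image, compare [phi] with
    the quadratic [psi] on the half cube on which the coordinate [i] is
    positive.  On the outer faces [psi] exceeds [2 * M], the bound of [phi].  The
    mirror lies halfway between two grid layers, and no boundary value is available
    there: instead, oddness of [phi] bounds [phi - psi] on the layer just behind
    the mirror by its opposite on the layer in front of it. *)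
Lemma discrete_gradient_le_sided h d M u i : (0 < n)%N -> 0 < h -> h <= d ->
  (forall z, `|z| < d -> dlap h u z = 0) ->
  (forall z, `|z| < 2 * d -> `|u z| <= M) ->
  u ((h / 2) *: delta_mx 0 i) - u (- ((h / 2) *: delta_mx 0 i))
    <= 2 * (n%:R + 1) * M / d * h.
Proof.
move=> n0 h0 hd lapu uM.
have d0 : 0 < d by exact: lt_le_trans hd.
have M0 : 0 <= M.
  by rewrite (le_trans _ (uM 0 _))// normr0 mulr_gt0.
pose N : R := n%:R; have N0 : 0 <= N by exact: ler0n.
pose K := 2 * M / d ^+ 2.
have K0 : 0 <= K by rewrite divr_ge0 ?mulr_ge0 ?exprn_ge0// ltW.
have Kd : K * d ^+ 2 = 2 * M by rewrite divfK// expf_neq0// gt_eqF.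
pose phi z := u z - u (reflection i z).
(* Up to the factor [K], the quadratic part [sqnorm z - n * z 0 i ^+ 2] is discrete
   harmonic; the linear term keeps [psi] nonnegative for [0 <= z 0 i <= 2 * d],
   and the constant makes [psi z + psi (reflection i z)] nonnegative on the layer
   [z 0 i = h / 2] next to the mirror. *)
pose psi z :=
  K * (sqnorm z + (2 * N * d * z 0 i + (- N * z 0 i ^+ 2 + N * h ^+ 2 / 4))).
pose f z := phi z - psi z.
pose S z := `|z| < d /\ exists m : nat, z 0 i = h / 2 + m%:R * h.
(* The positive part of [f], cut off outside of the grid layers in front of the
   mirror. *)
pose F z := if `[< S z >] then Num.max 0 (f z) else 0.
have phiM z : `|z| < 2 * d -> phi z <= 2 * M.
  move=> zd; have := uM _ zd.
  have := uM _ (le_lt_trans (norm_reflection i z) zd).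
  by rewrite !ler_norml /phi => /andP[? ?] /andP[? ?]; lra.
have psige z : `|z| < 2 * d -> 0 < z 0 i -> K * sqnorm z <= psi z.
  move=> zd zi0; rewrite ler_wpM2l// lerDl.
  have zi : z 0 i < 2 * d.
    by rewrite (le_lt_trans (ler_norm _))// (le_lt_trans (norm_rV_coord _ _)).
  have : 0 <= N * (z 0 i * (2 * d - z 0 i)).
    by rewrite mulr_ge0// mulr_ge0 ?subr_ge0 ?ltW.
  have : 0 <= N * h ^+ 2 by rewrite mulr_ge0 ?sqr_ge0.
  lra.
have posi (z : 'rV[R]_n) (m : nat) : z 0 i = h / 2 + m%:R * h -> 0 < z 0 i.
  by move=> ->; rewrite ltr_pwDl ?divr_gt0// mulr_ge0// ltW.
have lappsi z : dlap h psi z = 0.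
  rewrite /psi dlapZ dlapD dlap_sqnorm dlapD dlapZ dlap_coord dlapD dlap_cst dlapZ.
  by rewrite dlap_coord_sq; ring.
have lapf z : `|z| < d -> dlap h f z = 0.
  move=> zd; rewrite /f dlapB lappsi /phi dlapB dlap_reflection !lapu//.
    by rewrite !subr0.
  by rewrite (le_lt_trans (norm_reflection _ _)).
have Fpos z : 0 < F z -> S z /\ F z = f z.
  rewrite /F; case: asboolP => [Sz|]; last by rewrite ltxx.
  by rewrite lt_max ltxx/= => fz; split=> //; rewrite max_r// ltW.
have F0 z : 0 <= F z.
  by rewrite /F; case: ifP => // _; rewrite le_max lexx.
have fout z : `|z| < 2 * d -> (exists m : nat, z 0 i = h / 2 + m%:R * h) ->
    f z <= F z.
  move=> zd zi; have [Sz|nS] := pselect (S z).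
    by rewrite /F asboolT// le_max lexx orbT.
  rewrite (le_trans _ (F0 _))// subr_le0 (le_trans (phiM _ zd))//.
  case: (zi) => m /posi zi0; rewrite (le_trans _ (psige _ zd zi0))//.
  rewrite -Kd ler_wpM2l// (le_trans _ (le_sqnorm z))//.
  rewrite lerXn2r ?nnegrE ?(ltW d0)// leNgt; apply/negP => zd'.
  by apply: nS.
have frefl z : z 0 i = h / 2 -> f (reflection i z) <= - f z.
  move=> zi; rewrite /f /phi reflectionK /psi sqnorm_reflection reflectionE eqxx.
  rewrite zi; have : 0 <= K * sqnorm z by rewrite mulr_ge0 ?sqnorm_ge0.
  by move: (u z) (u _) (sqnorm z) => A B C; lra.
have nbr z t j : 0 < F z -> t = h \/ t = - h ->
    f (z + t *: delta_mx 0 j) <= F (z + t *: delta_mx 0 j).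
  move=> /[dup] Fz /Fpos[[zd [m zi]] Ff] th.
  have zd' : `|z + t *: delta_mx 0 j| < 2 * d.
    have tE : `|t| = h by case: th => ->; rewrite ?normrN gtr0_norm.
    by rewrite (le_lt_trans (norm_shift_le _ _ _))// tE; lra.
  have [ij|ij] := eqVneq i j; last first.
    by apply: fout => //; exists m; rewrite shiftE (negPf ij) mulr0 addr0.
  rewrite -ij in zd' *; case: th => tE.
    apply: fout => //; exists m.+1.
    by rewrite shiftE eqxx mulr1 zi tE; ring.
  case: m zi => [|m] zi; last first.
    by apply: fout => //; exists m; rewrite shiftE eqxx mulr1 zi tE; ring.
  rewrite mul0r addr0 in zi.
  have -> : z + t *: delta_mx 0 i = reflection i z.
    apply/rowP => k; rewrite shiftE reflectionE tE.
    by case: (k =P i) => [->|_]; rewrite ?zi /=; lra.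
  by rewrite (le_trans (frefl _ zi))// (le_trans _ (F0 _))// oppr_le0 -Ff ltW.
have FM : exists B, forall z, F z <= B.
  exists (2 * M) => z; have [Fz|Fz] := ltP 0 (F z); last first.
    by rewrite (le_trans Fz)// mulr_ge0.
  have [[zd [m zi]] ->] := Fpos _ Fz.
  have zd' : `|z| < 2 * d by lra.
  have := phiM _ zd'; have := psige _ zd' (posi _ _ zi).
  have : 0 <= K * sqnorm z by rewrite mulr_ge0 ?sqnorm_ge0.
  rewrite /f; lra.
have Fle : forall z, F z <= 0.
  apply: (dlap_max_principle n0 h0 FM).
    by exists d => z /Fpos[[zd _] _]; exact: ltW.
  move=> z Fz; have [[zd _] Ff] := Fpos _ Fz.
  rewrite -(lapf _ zd); apply: dlap_le => // j; rewrite -?scaleNr; apply: nbr => //.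
    by left.
  by right.
set z0 := (h / 2) *: delta_mx 0 i.
have z0i : z0 0 i = h / 2 by rewrite !mxE !eqxx mulr1.
have z0d : `|z0| < d by rewrite norm_scale_delta gtr0_norm ?divr_gt0//; lra.
have : f z0 <= 0.
  apply: le_trans (Fle z0); apply: fout; first by lra.
  by exists 0%N; rewrite z0i mul0r addr0.
have -> : - z0 = reflection i z0.
  apply/rowP => k; rewrite reflectionE !mxE /=.
  by case: (k == i) => //=; rewrite mulr0 oppr0.
rewrite subr_le0 => /le_trans; apply.
have -> : psi z0 = K * (h ^+ 2 / 4 + N * d * h).
  rewrite /psi z0i -[z0]add0r sqnorm_shift mxE /sqnorm big1; first by field.
  by move=> k _; rewrite mxE expr0n.
have -> : 2 * (N + 1) * M / d * h = K * ((N + 1) * d * h).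
  by rewrite /K; field; rewrite gt_eqF.
rewrite ler_wpM2l//.
have : h * h <= d * h by rewrite ler_pM2r.
have : 0 <= h * h by rewrite mulr_ge0 ?ltW.
lra.
Qed.

Lemma discrete_gradient_le h d M u i : (0 < n)%N -> 0 < h -> h <= d ->
  (forall z, `|z| < d -> dlap h u z = 0) ->
  (forall z, `|z| < 2 * d -> `|u z| <= M) ->
  `|u ((h / 2) *: delta_mx 0 i) - u (- ((h / 2) *: delta_mx 0 i))|
    <= 2 * (n%:R + 1) * M / d * h.
Proof.
move=> n0 h0 hd lapu uM; rewrite ler_norml; apply/andP; split; last first.
  exact: discrete_gradient_le_sided.
rewrite lerNl opprB addrC -[u (- _)]opprK.
apply: (@discrete_gradient_le_sided _ _ _ (fun z => - u z)) => // z zd.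
  by rewrite dlapN lapu ?oppr0.
by rewrite normrN uM.
Qed.

End GradientEstimate.

(** * Families of discrete harmonic functions *)

Section HarmonicFamily.
Context {R : realType} {n : nat}.
Implicit Types (x y z : 'rV[R]_n) (u : R -> 'rV[R]_n -> R).
Implicit Types (h r M C : R) (i j : 'I_n).

Definition fdiff i u h y : R :=
  h^-1 * (u h (y + h *: delta_mx 0 i) - u h y).

(** One radius bounds both the step and the distance to [x], because an expression
    in [u h] at [y] samples points at a distance of order [h] from [y]. *)
Definition harmonic_family u x := exists2 r : R, 0 < r &
  exists M, forall h y, 0 < h < r -> `|y - x| < r ->
    `|u h y| <= M /\ dlap h (u h) y = 0.

Lemma harmonic_family_near u x : harmonic_family u x ->
  exists2 r : R, 0 < r & forall y, `|y - x| < r -> harmonic_family u y.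
Proof.
move=> [r r0 [M uM]]; exists (r / 2); first by rewrite divr_gt0.
move=> y yx; exists (r / 2); first by rewrite divr_gt0.
exists M => h z hr zy; apply: uM; first by lra.
by rewrite -(subrKA y) (le_lt_trans (ler_normD _ _))//; lra.
Qed.

Lemma dlap_fdiff i u h y : dlap h (fdiff i u h) y =
  h^-1 * (dlap h (u h) (y + h *: delta_mx 0 i) - dlap h (u h) y).
Proof.
rewrite /fdiff (dlapZ h h^-1 (fun y => u h (y + h *: delta_mx 0 i) - u h y)).
by rewrite dlapB dlap_shift.
Qed.

Lemma harmonic_family_fdiff i u x : (0 < n)%N ->
  harmonic_family u x -> harmonic_family (fdiff i u) x.
Proof.
move=> n0 [r r0 [M uM]]; exists (r / 8); first by rewrite divr_gt0.
exists (2 * (n%:R + 1) * M / (r / 4)) => h y /andP[h0 hr] yx.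
have hr8 : `|h| < r / 8 by rewrite gtr0_norm.
have hr0 : 0 < h < r by lra.
have lapu z : `|z - x| < r -> dlap h (u h) z = 0 by move=> /(uM _ _ hr0)[].
split; last first.
  rewrite dlap_fdiff !lapu ?subrr ?mulr0//; first by lra.
  rewrite addrAC (le_lt_trans (norm_shift_le _ _ _))//; lra.
rewrite /fdiff normrM gtr0_norm ?invr_gt0// mulrC ler_pdivrMr//.
(* The mirror is the hyperplane halfway between [y] and its neighbour. *)
pose c := y + (h / 2) *: delta_mx 0 i.
have cx z : `|z| < r / 2 -> `|z + c - x| < r.
  move=> zr; have -> : z + c - x = z + (y - x) + (h / 2) *: delta_mx 0 i.
    by apply/rowP => k; rewrite /c !mxE; ring.
  rewrite (le_lt_trans (norm_shift_le _ _ _))//.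
  have := ler_normD z (y - x); rewrite normrM gtr0_norm ?[`|2^-1|]gtr0_norm//; lra.
have -> : y + h *: delta_mx 0 i = (h / 2) *: delta_mx 0 i + c.
  by rewrite /c addrCA -scalerDl -splitr.
have {1}-> : y = - ((h / 2) *: delta_mx 0 i) + c.
  by rewrite /c addrCA addNr addr0.
apply: (@discrete_gradient_le _ _ _ _ _ (fun z => u h (z + c))) => //.
- lra.
- by move=> z zr; rewrite dlap_shift lapu// cx//; lra.
- by move=> z zr; apply: (uM _ _ hr0 _).1; apply: cx; lra.
Qed.

Lemma fdiff_telescope i u h y (m : nat) : h != 0 ->
  u h (y + ((m.+1)%:R * h) *: delta_mx 0 i) =
  u h (y + (m%:R * h) *: delta_mx 0 i)
    + h * fdiff i u h (y + (m%:R * h) *: delta_mx 0 i).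
Proof.
move=> h0; rewrite /fdiff mulVKf// [RHS]addrC subrK -addrA -scalerDl.
by congr (u h (_ + _ *: _)); rewrite -natr1; ring.
Qed.

(** Second-order difference quotients form a harmonic family, hence are bounded
    uniformly in [h]; summing them twice along the segment gives the remainder of
    the Taylor expansion. *)
Lemma harmonic_family_taylor i u x : (0 < n)%N -> harmonic_family u x ->
  exists2 r : R, 0 < r & exists C, forall h y (k : int),
    0 < h < r -> `|y - x| < r -> `|k%:~R * h| < r ->
    `|u h (y + (k%:~R * h) *: delta_mx 0 i) - u h y
       - k%:~R * h * fdiff i u h y| <= C * (k%:~R * h) ^+ 2.
Proof.
move=> n0 /(harmonic_family_fdiff i n0)/(harmonic_family_fdiff i n0).
move=> [r0 r00 [C0 uC]]; pose C := `|C0|.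
pose r := r0 / 4; have rr : 0 < r by rewrite divr_gt0.
pose D := fdiff i u.
have DDC h y : 0 < h < r -> `|y - x| < 3 * r -> `|fdiff i D h y| <= C.
  move=> hr yr; apply: le_trans (ler_norm _); apply: (uC _ _ _ _).1.
    by rewrite /r in hr; lra.
  by rewrite /r in yr; lra.
have step h y (m : nat) : 0 < h < r -> `|y - x| < 2 * r ->
    m%:R * h < r -> `|y + (m%:R * h) *: delta_mx 0 i - x| < 3 * r.
  move=> /andP[h0 _] yr mh; rewrite addrAC (le_lt_trans (norm_shift_le _ _ _))//.
  rewrite [`|_ * _|]ger0_norm ?mulr_ge0 ?(ltW h0)//; lra.
have lt_step h (m : nat) : 0 < h -> m.+1%:R * h < r -> m%:R * h < r.
  move=> h0; apply: le_lt_trans; rewrite ler_pM2r// ler_nat//.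
have estD h y (m : nat) : 0 < h < r -> `|y - x| < 2 * r -> m%:R * h < r ->
    `|D h (y + (m%:R * h) *: delta_mx 0 i) - D h y| <= C * (m%:R * h).
  move=> /[dup] hr /andP[h0 _] yr.
  elim: m => [|m IH] mh; first by rewrite mul0r scale0r addr0 subrr normr0 mulr0.
  have mh' := lt_step _ _ h0 mh.
  rewrite fdiff_telescope ?gt_eqF// addrAC.
  rewrite (le_trans (ler_normD _ _))// -natr1 mulrDl mulrDr mul1r lerD ?IH//.
  by rewrite normrM gtr0_norm// mulrC ler_pM2r// DDC// step.
have estU h y (m : nat) : 0 < h < r -> `|y - x| < 2 * r -> m%:R * h < r ->
    `|u h (y + (m%:R * h) *: delta_mx 0 i) - u h y - m%:R * h * D h y|
      <= C * (m%:R * h) ^+ 2.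
  move=> /[dup] hr /andP[h0 _] yr.
  elim: m => [|m IH] mh.
    by rewrite !mul0r scale0r addr0 subrr subr0 normr0 expr0n mulr0.
  have mh' := lt_step _ _ h0 mh.
  rewrite fdiff_telescope ?gt_eqF//.
  have := IH mh'; have := estD h y m hr yr mh'; rewrite -/D.
  set A := u h (_ + _); set B := D h (_ + _).
  have mh0 : 0 <= m%:R * h by rewrite mulr_ge0// ltW.
  rewrite -natr1 !ler_norml => /andP[H1 H2] /andP[H3 H4].
  have := ler_wpM2l (ltW h0) H1; have := ler_wpM2l (ltW h0) H2.
  have Ch : 0 <= C * (h * h) by rewrite mulr_ge0 ?normr_ge0// mulr_ge0// ltW.
  have Cm : 0 <= C * (h * (m%:R * h)).
    by rewrite mulr_ge0 ?normr_ge0// mulr_ge0// ltW.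
  move: H3 H4 Ch Cm; rewrite mulrDl mul1r.
  move: (m%:R * h) (D h y) (u h y) => a b c H3 H4 Ch Cm H5 H6.
  by apply/andP; split; lra.
exists r => //; exists (2 * C) => h y k /[dup] hr /andP[h0 _] yr kr.
have y2r : `|y - x| < 2 * r by lra.
have C0' : 0 <= C by exact: normr_ge0.
case: (intP k) kr => [|m|m] kr.
- by rewrite !mul0r scale0r addr0 subrr subr0 normr0 expr0n mulr0.
- rewrite -pmulrn in kr *; rewrite (le_trans (estU _ _ _ hr y2r _))//.
    exact: le_lt_trans (ler_norm _) kr.
  by rewrite ler_wpM2r ?sqr_ge0//; lra.
- rewrite mulrNz -pmulrn !mulNr in kr *; rewrite normrN in kr.
  rewrite sqrrN; have kr' := le_lt_trans (ler_norm _) kr.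
  set y' := y + _; have yE : y = y' + (m.+1%:R * h) *: delta_mx 0 i.
    by rewrite /y' -addrA scaleNr addNr addr0.
  have y'r : `|y' - x| < 2 * r.
    rewrite /y' addrAC (le_lt_trans (norm_shift_le _ _ _))// normrN; lra.
  have := estU h y' m.+1 hr y'r kr'; have := estD h y' m.+1 hr y'r kr'.
  rewrite -yE !ler_norml => /andP[H1 H2] /andP[H3 H4].
  have mh0 : 0 <= m.+1%:R * h by rewrite mulr_ge0// ltW.
  have := ler_wpM2l mh0 H1; have := ler_wpM2l mh0 H2.
  move: H3 H4; rewrite -/D; move: (m.+1%:R * h) (D h y) (D h y') => a b c.
  by move=> *; apply/andP; split; lra.
Qed.

End HarmonicFamily.

(** * Partial derivatives and finite increments *)

Section FiniteIncrements.
Context {R : realType} {n : nat}.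
Implicit Types (x y z v : 'rV[R]_n) (f : 'rV[R]_n -> R).
Implicit Types (r s t l C : R) (i j : 'I_n).

Lemma norm_rV_lt x r : 0 < r -> (forall j, `|x 0 j| < r) -> `|x| < r.
Proof.
move=> r0 xr; have [->//|x0] := eqVneq `|x| 0.
by have [[i j] /= xE] := mx_norm_neq0 x0; rewrite [`|x|]xE (ord1 i).
Qed.

Lemma near_normP x (P : set 'rV[R]_n) : (\forall y \near x, P y) <->
  exists2 r, 0 < r & forall y, `|y - x| < r -> P y.
Proof.
by split=> [/nbhs_normP|] [r /= r0 rP]; [|apply/nbhs_normP]; exists r => //= y;
   rewrite /ball_/= distrC; exact: rP.
Qed.

Lemma continuous_normP x f :
  (forall e : R, 0 < e ->
     exists2 r, 0 < r & forall y, `|y - x| < r -> `|f y - f x| <= e) ->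
  {for x, continuous f}.
Proof.
move=> fx; have /cvgrPdist_le : forall e : R, 0 < e ->
    \forall y \near x, `|f x - f y| <= e.
  move=> e /fx[r r0 rf]; apply/near_normP; exists r => // y /rf.
  by rewrite distrC.
by [].
Qed.

Lemma is_derive_of_taylor f x v l r C : 0 < r ->
  (forall t, `|t| < r -> `|f (x + t *: v) - f x - t * l| <= C * t ^+ 2) ->
  is_derive x v f l.
Proof.
move=> r0 fC.
suff fl : h^-1 *: ((f \o shift x) (h *: v) - f x) @[h --> 0^'] --> l.
  by apply: DeriveDef; [apply/cvg_ex; exists l|exact: cvg_lim].
apply/cvgrPdist_le => e e0; near=> t.
have t0 : t != 0 by near: t; exact: nbhs_dnbhs_neq.
have tr : `|t| < r by near: t; apply: dnbhs0_lt.
have te : `|t| < e / (`|C| + 1).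
  by near: t; apply: dnbhs0_lt; rewrite divr_gt0// ltr_wpDl.
have := fC t tr; rewrite /= [t *: v + x]addrC.
have -> : l - t^-1 *: (f (x + t *: v) - f x) =
    - (t^-1 * (f (x + t *: v) - f x - t * l)).
  by rewrite /GRing.scale /=; field.
move=> ft; rewrite normrN normrM normfV mulrC ler_pdivrMr ?normr_gt0//.
rewrite (le_trans ft)// -real_normK ?num_real// expr2 mulrA.
rewrite ler_wpM2r// (le_trans (ler_norm _))// normrM normr_id.
move: te; rewrite ltr_pdivlMr ?ltr_wpDl// => te.
have : 0 <= `|t| by []; lra.
Unshelve. all: by end_near. Qed.

(** Restricting to a line turns directional derivatives into ordinary ones. *)
Lemma is_derive_line f x v t : derivable f (x + t *: v) v ->
  is_derive t 1 (fun s => f (x + s *: v)) ('D_v f (x + t *: v)).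
Proof.
have E : (fun h : R => h^-1 *: (((fun s : R => f (x + s *: v)) \o shift t)
             (h *: 1) - f (x + t *: v))) =
         (fun h : R => h^-1 *: ((f \o shift (x + t *: v)) (h *: v)
             - f (x + t *: v))).
  apply/funext => h /=; congr (_ *: (f _ - _)).
  by rewrite (_ : h *: (1 : R) = h) ?scalerDl 1?addrCA//; exact: mulr1.
by move=> df; apply: DeriveDef; rewrite /derivable /derive /= E.
Qed.

(** The mean value theorem along a segment of any sign.  That [t] is nonzero for a
    nondegenerate segment is what makes second-order information at [x] usable. *)
Lemma line_increment f x v s : (forall t, 0 <= t <= s \/ s <= t <= 0 ->
    derivable f (x + t *: v) v) ->
  exists t, [/\ 0 <= t <= s \/ s <= t <= 0, s != 0 -> t != 0 &
    f (x + s *: v) - f x = 'D_v f (x + t *: v) * s].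
Proof.
move=> df; pose g t := f (x + t *: v).
have dg t : 0 <= t <= s \/ s <= t <= 0 -> is_derive t 1 g ('D_v f (x + t *: v)).
  by move=> ts; apply: is_derive_line; exact: df.
have cg a b : (forall t, a <= t <= b -> 0 <= t <= s \/ s <= t <= 0) ->
    {within `[a, b], continuous g}.
  move=> ab; apply: derivable_within_continuous => t.
  by rewrite in_itv => /ab/dg => -[].
have gs : f (x + s *: v) = g s by [].
have -> : f x = g 0 by rewrite /g scale0r addr0.
rewrite gs; have [s0|s0|<-] := ltgtP 0 s.
- have [||t] := @MVT _ g (fun t => 'D_v f (x + t *: v)) 0 s s0.
  + by move=> t; rewrite in_itv/= => /andP[? ?]; apply: dg; left; rewrite !ltW.
  + by apply: cg => t; left.
  rewrite in_itv/= subr0 => /andP[t0 ts] ->; exists t; split=> //.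
    by left; rewrite !ltW.
  by rewrite gt_eqF.
- have [||t] := @MVT _ g (fun t => 'D_v f (x + t *: v)) s 0 s0.
  + by move=> t; rewrite in_itv/= => /andP[? ?]; apply: dg; right; rewrite !ltW.
  + by apply: cg => t; right.
  rewrite in_itv/= sub0r => /andP[ts t0] E; exists t; split.
  + by right; rewrite !ltW.
  + by rewrite lt_eqF.
  + by rewrite -opprB E mulrN opprK.
- by exists 0; split; [left; rewrite lexx|rewrite eqxx|rewrite subrr mulr0].
Qed.

(** Go from [y] to [z] by changing one coordinate at a time, which stays in the
    cube, and apply the mean value theorem to each change. *)
Lemma lipschitz_of_partial f x r C :
  (forall y i, `|y - x| < r ->
    derivable f y (delta_mx 0 i) /\ `|partial i f y| <= C) ->
  forall y z, `|y - x| < r -> `|z - x| < r -> `|f z - f y| <= n%:R * C * `|z - y|.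
Proof.
move=> df y z yr zr; have r0 : 0 < r by exact: le_lt_trans yr.
(* [w k] takes its first [k] coordinates from [z] and the others from [y]. *)
pose w (k : nat) : 'rV[R]_n := \row_j (if (j < k)%N then z 0 j else y 0 j).
have -> : f z = f (w n) by congr f; apply/rowP => j; rewrite mxE ltn_ord.
have -> : f y = f (w 0%N) by congr f; apply/rowP => j; rewrite mxE.
rewrite -(telescope_sumr (fun k => f (w k)) (leq0n n)) big_mkord.
rewrite (le_trans (ler_norm_sum _ _ _))//.
have -> : n%:R * C * `|z - y| = \sum_(k < n) C * `|z - y|.
  by rewrite sumr_const card_ord -mulrA mulr_natl.
apply: ler_sum => k _.
have -> : w k.+1 = w k + (z 0 k - y 0 k) *: delta_mx 0 k.
  apply/rowP => j; rewrite shiftE !mxE ltnS leq_eqVlt.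
  have [->|jk] := eqVneq j k; first by rewrite eqxx ltnn/=; ring.
  by rewrite (negPf (_ : (j != k :> nat)))// mulr0 addr0.
have wr t : 0 <= t <= z 0 k - y 0 k \/ z 0 k - y 0 k <= t <= 0 ->
    `|w k + t *: delta_mx 0 k - x| < r.
  move=> ht; apply: norm_rV_lt => // j.
  have := le_lt_trans (norm_rV_coord (y - x) j) yr.
  have := le_lt_trans (norm_rV_coord (z - x) j) zr.
  rewrite !mxE/= !ltr_norml => /andP[? ?] /andP[? ?].
  have [jk|jk] := eqVneq j k; last by rewrite mulr0; case: ifP => _; lra.
  by move: ht; rewrite jk ltnn mulr1 -jk => -[/andP[? ?]|/andP[? ?]]; lra.
have [t [ht _ ->]] := line_increment (fun t ht => (df _ k (wr t ht)).1).
rewrite normrM ler_pM//; first exact: (df _ k (wr t ht)).2.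
by have := norm_rV_coord (z - y) k; rewrite !mxE.
Qed.

End FiniteIncrements.

(** * Limits of discrete harmonic functions *)

Section HarmonicLimit.
Context {R : realType} {n : nat} (U : set_system R).
Hypothesis ultraU : UltraFilter U.
Hypothesis rightU : 0^'+ `<=` U.
Implicit Types (x y z : 'rV[R]_n) (u : R -> 'rV[R]_n -> R).
Implicit Types (h r t M C : R) (i j : 'I_n).

#[local] Instance properU : ProperFilter U := @ultra_proper _ _ ultraU.

Lemma near_ultra r (P : set R) : 0 < r -> (forall h, 0 < h < r -> P h) ->
  \forall h \near U, P h.
Proof.
move=> r0 rP; apply: rightU; near=> h; apply: rP; apply/andP; split.
  by near: h; exact: nbhs_right_gt.
by near: h; exact: nbhs_right_lt.
Unshelve. all: by end_near. Qed.

(** A bounded real function converges along an ultrafilter, by compactness. *)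
Lemma ultra_cvg (f : R -> R) r M : 0 < r ->
  (forall h, 0 < h < r -> `|f h| <= M) -> f h @[h --> U] --> lim (f h @[h --> U]).
Proof.
move=> r0 fM; apply/cvg_ex.
have := @segment_compact R (- M) M; rewrite compact_ultra => /(_ (f h @[h --> U])).
case=> [||l [_ fl]]; last by exists l.
- split=> [|G GF fG]; first exact: fmap_proper_filter.
  apply/seteqP; split=> // A GA.
  have [//|UA] := in_ultra_setVsetC (f @^-1` A) ultraU.
  have /fG GA' : (f h @[h --> U]) (~` A) by [].
  have := @filterI _ _ GF _ _ GA GA'; rewrite setICr => G0.
  by case: (@filter_not_empty _ _ GF G0).
- apply: (near_ultra r0) => h /fM; rewrite ler_norml => ?.
  by rewrite /= in_itv.
Qed.

(** All coordinates are rounded to multiples of [h]: points rounded with the same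
    [h] can be joined by steps of length [h], along which difference quotients
    control the variation of [u h].  Values of [u h] at points outside of a common
    grid are unrelated. *)
Definition grid_point h x : 'rV[R]_n :=
  \row_j ((Num.floor (x 0 j / h))%:~R * h).

Lemma grid_point_dist h x : 0 < h -> `|grid_point h x - x| <= h.
Proof.
move=> h0; apply: norm_rV_le => [|j]; first exact: ltW.
rewrite !mxE; have /andP[] := floor_itv (x 0 j / h).
rewrite ler_pdivlMr// ltr_pdivrMr// intrD mulrDl mul1r.
by rewrite ler_norml => ? ?; apply/andP; split; lra.
Qed.

Lemma grid_point_shift h x t i : 0 < h -> exists2 k : int,
  grid_point h (x + t *: delta_mx 0 i)
    = grid_point h x + (k%:~R * h) *: delta_mx 0 i &
  `|k%:~R * h - t| <= h.
Proof.
move=> h0; exists (Num.floor ((x 0 i + t) / h) - Num.floor (x 0 i / h)).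
  apply/rowP => j; rewrite !mxE /=.
  have [->|ji] := eqVneq j i; last by rewrite !mulr0 !addr0.
  by rewrite !mulr1 intrB; ring.
have /andP[] := floor_itv (x 0 i / h).
have /andP[] := floor_itv ((x 0 i + t) / h).
rewrite !ler_pdivlMr// !ltr_pdivrMr// !intrD !mulrDl mul1r mulrNz.
by rewrite ler_norml => ? ? ? ?; apply/andP; split; lra.
Qed.

Definition ulimit u x : R := lim (u h (grid_point h x) @[h --> U]).

Lemma ulimit_cvg u x : harmonic_family u x ->
  u h (grid_point h x) @[h --> U] --> ulimit u x.
Proof.
move=> [r r0 [M uM]]; apply: (@ultra_cvg _ r M) => // h hr.
by apply: (uM _ _ hr _).1; case/andP: hr => h0 /(le_lt_trans _); apply;
   exact: grid_point_dist.
Qed.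

Lemma ulimit_le u x r M : 0 < r ->
  (forall h y, 0 < h < r -> `|y - x| < r -> u h y <= M) ->
  harmonic_family u x -> ulimit u x <= M.
Proof.
move=> r0 uM /ulimit_cvg ul; apply: (cvgr_to_le ul).
apply: (near_ultra r0) => h /[dup] hr /andP[h0 h1]; apply: uM => //.
by rewrite (le_lt_trans (grid_point_dist _ _)).
Qed.

Lemma ulimit_ge u x r M : 0 < r ->
  (forall h y, 0 < h < r -> `|y - x| < r -> M <= u h y) ->
  harmonic_family u x -> M <= ulimit u x.
Proof.
move=> r0 uM /ulimit_cvg ul; apply: (cvgr_to_ge ul).
apply: (near_ultra r0) => h /[dup] hr /andP[h0 h1]; apply: uM => //.
by rewrite (le_lt_trans (grid_point_dist _ _)).
Qed.

(** The discrete Taylor bound passes to the limit, since the rounded increment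
    [k * h] tends to [t]. *)
Lemma ulimit_taylor i u x : (0 < n)%N -> harmonic_family u x ->
  exists2 r, 0 < r & exists C, forall t, `|t| < r ->
    `|ulimit u (x + t *: delta_mx 0 i) - ulimit u x - t * ulimit (fdiff i u) x|
      <= C * t ^+ 2.
Proof.
move=> n0 ux; have [r1 r10 ux1] := harmonic_family_near ux.
have [r2 r20 [C taylor]] := harmonic_family_taylor i n0 ux.
exists (Num.min r1 r2); first by rewrite lt_min r10.
exists C => t; rewrite lt_min => /andP[tr1 tr2].
have k_ex h : exists k : int, 0 < h ->
    grid_point h (x + t *: delta_mx 0 i)
      = grid_point h x + (k%:~R * h) *: delta_mx 0 i /\ `|k%:~R * h - t| <= h.
  have [h0|_] := ltP 0 h; last by exists 0.
  by have [k ? ?] := grid_point_shift x t i h0; exists k.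
have [k kP] := choice k_ex.
have kt : (k h)%:~R * h @[h --> U] --> t.
  apply/cvgrPdist_le => e e0; apply: (near_ultra e0) => h /andP[h0 he].
  by rewrite distrC (le_trans (kP h h0).2)// ltW.
have uxt := @ulimit_cvg _ _ (ux1 (x + t *: delta_mx 0 i) _).
have {}uxt := uxt _; rewrite addrAC subrr add0r norm_scale_delta in uxt.
have {}uxt := uxt tr1.
have ux0 := ulimit_cvg ux.
have uxD := ulimit_cvg (harmonic_family_fdiff i n0 ux).
have lhs : `|u h (grid_point h (x + t *: delta_mx 0 i)) - u h (grid_point h x)
      - (k h)%:~R * h * fdiff i u h (grid_point h x)| @[h --> U] -->
    `|ulimit u (x + t *: delta_mx 0 i) - ulimit u x
      - t * ulimit (fdiff i u) x|.
  by apply: cvg_norm; apply: cvgB; [exact: cvgB|exact: cvgM].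
have rhs : C * ((k h)%:~R * h * ((k h)%:~R * h)) @[h --> U] --> C * (t * t).
  by apply: cvgMl_tmp; exact: cvgM.
rewrite expr2; apply: (ler_cvg_to lhs rhs).
have d0 : 0 < Num.min (r2 - `|t|) r2 by rewrite lt_min subr_gt0 tr2.
apply: (near_ultra d0) => h /andP[h0]; rewrite lt_min => /andP[ht hr].
have [gE kh] := kP h h0; rewrite /= gE -expr2; apply: taylor.
- by rewrite h0.
- by rewrite (le_lt_trans (grid_point_dist _ _)).
- have := ler_normD ((k h)%:~R * h - t) t; rewrite subrK => /le_lt_trans; apply.
  by lra.
Qed.

Lemma is_derive_ulimit i u x : (0 < n)%N -> harmonic_family u x ->
  is_derive x (delta_mx 0 i) (ulimit u) (ulimit (fdiff i u) x).
Proof.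
move=> n0 /(ulimit_taylor i n0)[r r0 [C uC]].
exact: is_derive_of_taylor r0 uC.
Qed.

Lemma ulimit_bounded_near u x : harmonic_family u x ->
  exists M, \forall y \near x, `|ulimit u y| <= M.
Proof.
move=> ux; have [r1 r10 ux1] := harmonic_family_near ux.
have [r r0 [M uM]] := ux; exists M; apply/near_normP.
have r20 : 0 < r / 2 by rewrite divr_gt0.
exists (Num.min r1 (r / 2)); first by rewrite lt_min r10.
move=> y; rewrite lt_min => /andP[/ux1 uy yr].
have uMy h z : 0 < h < r / 2 -> `|z - y| < r / 2 -> `|u h z| <= M.
  move=> hr zy; apply: (uM _ _ _ _).1; first by lra.
  by rewrite -(subrKA y) (le_lt_trans (ler_normD _ _))//; lra.
rewrite ler_norml; apply/andP; split.
  apply: (ulimit_ge r20 _ uy) => h z hr zy.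
  by have := uMy _ _ hr zy; rewrite ler_norml => /andP[].
apply: (ulimit_le r20 _ uy) => h z hr zy.
by have := uMy _ _ hr zy; rewrite ler_norml => /andP[].
Qed.

(** The partial derivatives are limits of harmonic families, hence bounded near
    [x]. *)
Lemma ulimit_continuous u x : (0 < n)%N -> harmonic_family u x ->
  {for x, continuous (ulimit u)}.
Proof.
move=> n0 ux; have [r1 r10 ux1] := harmonic_family_near ux.
have [M MP] := choice (fun i => ulimit_bounded_near (harmonic_family_fdiff i n0 ux)).
have {}MP : \forall y \near x, forall i, `|ulimit (fdiff i u) y| <= M i.
  exact: (@filter_forall _ _ (fun i y => `|ulimit (fdiff i u) y| <= M i) _ _ MP).
move/near_normP : MP => [r2 r20 MP].
pose C := \sum_i `|M i|; pose r := Num.min r1 r2.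
have r0 : 0 < r by rewrite lt_min r10.
have lip : forall y i, `|y - x| < r -> derivable (ulimit u) y (delta_mx 0 i) /\
    `|partial i (ulimit u) y| <= C.
  move=> y i; rewrite lt_min => /andP[/ux1 uy /MP/(_ i) My].
  have D := is_derive_ulimit i n0 uy; split; first exact: ex_derive.
  rewrite /partial derive_val (le_trans My)// (le_trans (ler_norm _))//.
  by rewrite /C (bigD1 i)//= lerDl sumr_ge0.
have C0 : 0 <= n%:R * C by rewrite mulr_ge0 ?sumr_ge0.
apply: continuous_normP => e e0; exists (Num.min r (e / (n%:R * C + 1))).
  by rewrite lt_min r0 divr_gt0// ltr_wpDl.
move=> y; rewrite lt_min => /andP[yr ye].
rewrite (le_trans (lipschitz_of_partial lip _ yr))//.
  by rewrite subrr normr0.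
move: ye; rewrite ltr_pdivlMr ?ltr_wpDl// => ye.
have : 0 <= `|y - x| by []; lra.
Qed.

End HarmonicLimit.

(** * Smoothness and harmonicity of the limit *)

Section HarmonicLimitSmooth.
Context {R : realType} {n : nat}.
Implicit Types (x y z : 'rV[R]_n) (u : R -> 'rV[R]_n -> R).
Implicit Types (f g : 'rV[R]_n -> R) (Omega : set 'rV[R]_n) (i j : 'I_n).

Lemma open_near Omega x (P : set 'rV[R]_n) : open Omega -> Omega x ->
  (forall y, Omega y -> P y) -> \forall y \near x, P y.
Proof.
by move=> oO Ox OP; apply: (filterS OP); apply: open_nbhs_nbhs; split.
Qed.

Lemma eq_continuous_at Omega f g x : open Omega ->
  (forall y, Omega y -> f y = g y) -> Omega x ->
  {for x, continuous f} -> {for x, continuous g}.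
Proof.
move=> oO fg Ox fx; have {}fx : f y @[y --> x] --> g x by rewrite -fg.
apply: cvg_trans fx; apply: (@near_eq_cvg _ _ (nbhs x)).
exact: (open_near oO Ox fg).
Qed.

Lemma eq_partial Omega i f g x : open Omega ->
  (forall y, Omega y -> f y = g y) -> Omega x -> partial i f x = partial i g x.
Proof.
move=> oO fg Ox; apply: near_eq_derive; exact: (open_near oO Ox fg).
Qed.

Lemma eq_Ck Omega k f g : open Omega ->
  (forall x, Omega x -> f x = g x) -> Ck k Omega f -> Ck k Omega g.
Proof.
move=> oO; elim: k f g => [|k IH] f g fg [fc fk]; split=> //.
- by move=> x Ox; apply: (eq_continuous_at oO fg) => //; exact: fc.
- by move=> x Ox; apply: (eq_continuous_at oO fg) => //; exact: fc.
- move=> i; have [fd fCk] := fk i; split=> [x Ox|].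
    apply: (near_eq_derivable _ (fd x Ox)).
    exact: (open_near oO Ox fg).
  apply: IH fCk => x Ox; exact: (eq_partial i oO fg Ox).
Qed.

Context (U : set_system R).
Hypothesis ultraU : UltraFilter U.
Hypothesis rightU : 0^'+ `<=` U.
#[local] Instance properU' : ProperFilter U := @ultra_proper _ _ ultraU.

Lemma partial_ulimit i u x : (0 < n)%N -> harmonic_family u x ->
  partial i (ulimit U u) x = ulimit U (fdiff i u) x.
Proof.
by move=> n0 ux; apply: derive_val; exact: is_derive_ulimit.
Qed.

(** Induction on the order: partial derivatives are limits of the difference
    quotients, which form harmonic families as well. *)
Lemma Ck_ulimit Omega k u : (0 < n)%N -> open Omega ->
  (forall x, Omega x -> harmonic_family u x) -> Ck k Omega (ulimit U u).
Proof.
move=> n0 oO; elim: k u => [|k IH] u uO; split=> //.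
- by move=> x /uO; exact: ulimit_continuous.
- by move=> x /uO; exact: ulimit_continuous.
move=> i; split=> [x /uO ux|].
  by have D := is_derive_ulimit ultraU rightU i n0 ux; exact: ex_derive.
apply: (eq_Ck oO _ (IH (fdiff i u) _)).
  by move=> x /uO ux; rewrite partial_ulimit.
by move=> x /uO; exact: harmonic_family_fdiff.
Qed.

(** [fdiff] is a forward quotient, so iterating it twice gives second differences
    centred at [x + h *: delta_mx 0 i], a centre that depends on [i].  Moving all of
    them to the centre [x] costs a third difference times [h], and the sum of the
    centred ones is a multiple of [dlap h (u h) x]. *)
Lemma sum_fdiff2 u h x : h != 0 -> dlap h (u h) x = 0 ->
  \sum_(i < n) fdiff i (fdiff i u) h x =
  \sum_(i < n) h * fdiff i (fdiff i (fdiff i u)) h (x - h *: delta_mx 0 i).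
Proof.
move=> h0 ux; apply/eqP; rewrite -subr_eq0 -sumrB; apply/eqP.
transitivity (h^-1 ^+ 2 * dlap h (u h) x); last by rewrite ux mulr0.
rewrite mulr_sumr; apply: eq_bigr => i _.
rewrite [fdiff i (fdiff i (fdiff i u)) h _]/fdiff mulVKf// subrK opprB addrC subrK.
by rewrite /fdiff subrK; field.
Qed.

(** The third differences are bounded, so the error term of [sum_fdiff2] tends to
    [0] with [h]. *)
Lemma laplacian_ulimit Omega u x : (0 < n)%N -> open Omega ->
  (forall y, Omega y -> harmonic_family u y) -> Omega x ->
  laplacian (ulimit U u) x = 0.
Proof.
move=> n0 oO uO Ox; have Du i y : Omega y -> harmonic_family (fdiff i u) y.
  by move=> /uO; exact: harmonic_family_fdiff.
have DDu i : harmonic_family (fdiff i (fdiff i u)) x.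
  by apply: harmonic_family_fdiff => //; exact: Du.
rewrite /laplacian (eq_bigr (fun i => ulimit U (fdiff i (fdiff i u)) x)); last first.
  move=> i _; rewrite -partial_ulimit//; last exact: Du.
  by apply: (eq_partial i oO _ Ox) => y /uO uy; rewrite partial_ulimit.
have lim1 : \sum_(i < n) fdiff i (fdiff i u) h (grid_point h x) @[h --> U] -->
    \sum_(i < n) ulimit U (fdiff i (fdiff i u)) x.
  by apply: cvg_fin_sum => i _; exact: ulimit_cvg.
apply: (cvg_unique _ lim1) => //; have [r r0 [M uM]] := uO _ Ox.
apply: cvg_trans (_ : \sum_(i < n) h * fdiff i (fdiff i (fdiff i u)) h
  (grid_point h x - h *: delta_mx 0 i) @[h --> U] --> 0).
  apply: near_eq_cvg; apply: (near_ultra rightU r0) => h /[dup] hr /andP[h0 hr'].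
  rewrite sum_fdiff2 ?gt_eqF//; apply: (uM _ _ hr _).2.
  by rewrite (le_lt_trans (grid_point_dist _ _)).
rewrite [X in _ --> X](_ : _ = \sum_(i < n) (0 : R)); last by rewrite big1.
apply: cvg_fin_sum => i _; have [r1 r10 [C uC]] := harmonic_family_fdiff i n0 (DDu i).
apply/cvgr0Pnorm_le => e e0.
have d0 : 0 < Num.min (r1 / 2) (e / (`|C| + 1)).
  by rewrite lt_min !divr_gt0// ltr_wpDl.
apply: (near_ultra rightU d0) => h /andP[h0]; rewrite lt_min => /andP[hr1].
rewrite ltr_pdivlMr ?ltr_wpDl// => he; rewrite normrM gtr0_norm//.
have hr : 0 < h < r1 by lra.
have := (uC _ (grid_point h x - h *: delta_mx 0 i) hr _).1.
rewrite addrAC -scaleNr => /(_ _)/le_trans HC.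
rewrite (le_trans _ (ltW he))// ler_pM2l//.
rewrite (le_trans (HC _ _ (ler_norm _)))//; last by rewrite lerDl.
rewrite (le_lt_trans (norm_shift_le _ _ _))// normrN gtr0_norm//.
by have := grid_point_dist x h0; lra.
Qed.

End HarmonicLimitSmooth.

(** * Barriers at the boundary *)

Section Barrier.
Context {R : realType}.
Implicit Types (r e t C M : R).

Lemma is_derive_dotp n (a : 'I_n -> R) (x : 'rV[R]_n) i :
  is_derive x (delta_mx 0 i) (dotp a) (a i).
Proof.
apply: (@is_derive_of_taylor _ _ _ _ _ _ 1 0) => // t _.
by rewrite dotp_shift (addrC (dotp a x)) addrK subrr normr0 mul0r.
Qed.

Lemma continuous_bounded_near n (f : 'rV[R]_n -> R) x :
  {for x, continuous f} -> exists M, \forall y \near x, `|f y| <= M.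
Proof.
move=> fx; exists (`|f x| + 1).
have fx' : f y @[y --> x] --> f x := fx.
by apply: (@cvgr_norm_le _ _ _ (nbhs x) _ _ _ fx'); rewrite ltrDl.
Qed.

(** The partial derivatives of [f] minus its linear part at [x] are Lipschitz and
    vanish at [x], so they are bounded by a multiple of [`|y - x|] on a cube
    containing [y]; one more use of the increment bound gives the square. *)
Lemma C2_taylor n (f : 'rV[R]_n -> R) x : Ck 2 setT f ->
  exists2 r, 0 < r & exists2 C, 0 <= C & forall y, `|y - x| < r ->
    `|f y - f x - dotp (fun i => partial i f x) (y - x)| <= C * `|y - x| ^+ 2.
Proof.
move=> [_ fC2]; have [M MP] := choice (fun ij : 'I_n * 'I_n =>
  continuous_bounded_near (((fC2 ij.1).2.2 ij.2).2.1 x I)).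
have : \forall y \near x, forall ij : 'I_n * 'I_n,
    `|partial ij.2 (partial ij.1 f) y| <= M ij.
  exact: (@filter_forall _ _
    (fun ij y => `|partial ij.2 (partial ij.1 f) y| <= M ij) _ _ MP).
move=> /near_normP[r r0 {}MP]; pose C := \sum_ij `|M ij|.
have C0 : 0 <= C by apply: sumr_ge0.
have lip i y : `|y - x| < r ->
    `|partial i f y - partial i f x| <= n%:R * C * `|y - x|.
  move=> yr; apply: (@lipschitz_of_partial _ _ _ x r) => //; last first.
    by rewrite subrr normr0.
  move=> z j zr; split; first exact: ((fC2 i).2.2 j).1.
  rewrite (le_trans (MP z zr (i, j)))// (le_trans (ler_norm _))//.
  by rewrite /C (bigD1 (i, j))//= lerDl sumr_ge0.
(* Halving the radius leaves room for the open cube of radius [2 * `|y - x|]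
   around [x], which contains [y]. *)
exists (r / 2); first by rewrite divr_gt0.
exists (n%:R * (n%:R * C * 2)) => [|y yr]; first by rewrite !mulr_ge0.
have [->|yx] := eqVneq y x.
  rewrite !subrr (_ : dotp _ 0 = 0) ?subrr ?normr0 ?expr0n ?mulr0//.
  by rewrite /dotp big1// => i _; rewrite mxE mulr0.
pose s := `|y - x|; have s0 : 0 < s by rewrite normr_gt0 subr_eq0.
pose a i := partial i f x.
have D z i : is_derive z (delta_mx 0 i) (fun z => f z - dotp a z)
    (partial i f z - a i).
  have fz : is_derive z (delta_mx 0 i) f (partial i f z).
    by apply: derivableP; exact: (fC2 i).1.
  have az := is_derive_dotp a z i; exact: is_deriveB.
have := @lipschitz_of_partial _ _ (fun z => f z - dotp a z) x (2 * s)
  (n%:R * C * (2 * s)) _ x y.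
have -> : f y - dotp a y - (f x - dotp a x) = f y - f x - dotp a (y - x).
  have -> : dotp a (y - x) = dotp a y - dotp a x.
    by rewrite -sumrB; apply: eq_bigr => i _; rewrite !mxE; ring.
  by ring.
rewrite -/s => H; have {}H := H _ _ _.
rewrite (_ : _ * s ^+ 2 = n%:R * (n%:R * C * (2 * s)) * s); last by ring.
apply: H; [|by rewrite subrr normr0 mulr_gt0|by lra].
move=> z i zs; split; first by have [] := D z i.
rewrite /partial (@derive_val _ _ _ _ _ _ _ (D z i)).
rewrite (le_trans (lip i z _))//; first by rewrite /s in zs; lra.
by rewrite ler_wpM2l ?mulr_ge0// ltW.
Qed.

Lemma norm_col' n (k : 'I_n) (x : 'rV[R]_n) : `|col' k x| <= `|x|.
Proof. by apply: norm_rV_le => // j; rewrite mxE norm_rV_coord. Qed.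

(** The boundary point lies outside of the open set, so that it is on or below the
    graph of the function [gamma] describing the boundary, while [x] is above the
    graph; Taylor expansion of [gamma] at the boundary point bounds from below the
    height of [x] over the tangent plane. *)
Lemma boundary_paraboloid n (Omega : set 'rV[R]_n) x0 :
  open Omega -> C2_boundary Omega -> boundary Omega x0 ->
  exists a : 'I_n -> R, exists C r, [/\ 1 <= \sum_(i < n) a i ^+ 2, 0 <= C,
    0 < r & forall x, Omega x -> `|x - x0| < r ->
      - (C * sqnorm (x - x0)) <= dotp a (x - x0)].
Proof.
case: n Omega x0 => [|n] Omega x0 oO C2 bx0.
  by have [[]] := C2 _ bx0.
have nOx0 : ~ Omega x0.
  by case: bx0 => _; rewrite (interior_id _).1.
have [k [s [gamma [/C2_taylor T /near_normP[r1 r10 rO]]]]] := C2 _ bx0.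
have [r2 r20 [C C0 {}T]] := T (col' k x0).
pose b j := partial j gamma (col' k x0).
(* [dotp a] is the linear part of the height over the graph of [gamma], read in
   all coordinates. *)
pose a i := if unlift k i is Some j then - b j else (-1) ^+ s.
have ak : a k = (-1) ^+ s by rewrite /a unlift_none.
have dotpE z : dotp a z = (-1) ^+ s * z 0 k - dotp b (col' k z).
  rewrite /dotp (bigD1_ord k)//= ak; congr (_ + _).
  rewrite -sumrN; apply: eq_bigr => j _.
  by rewrite /a liftK mxE mulNr.
exists a, C, (Num.min r1 r2); split => //.
- by rewrite (bigD1 k)//= ak sqrr_sign lerDl sumr_ge0// => ? _; exact: sqr_ge0.
- by rewrite lt_min r10.
move=> x Ox; rewrite lt_min => /andP[xr1 xr2].
have gx : gamma (col' k x) < (-1) ^+ s * x 0 k by apply/rO.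
have gx0 : (-1) ^+ s * x0 0 k <= gamma (col' k x0).
  rewrite leNgt; apply/negP => gx0; apply: nOx0; apply/rO => //.
  by rewrite subrr normr0.
have cE : col' k x - col' k x0 = col' k (x - x0).
  by apply/rowP => j; rewrite !mxE.
have cn : `|col' k (x - x0)| <= `|x - x0| by exact: norm_col'.
have := T (col' k x); rewrite cE => /(_ (le_lt_trans cn xr2)).
rewrite ler_norml => /andP[+ _]; rewrite -/b dotpE !mxE.
have : C * `|col' k (x - x0)| ^+ 2 <= C * sqnorm (x - x0).
  rewrite ler_wpM2l// (le_trans _ (le_sqnorm _))//.
  by rewrite lerXn2r ?nnegrE.
lra.
Qed.

End Barrier.

Section BoundaryEstimate.
Context {R : realType} {n : nat}.
Implicit Types (x y z : 'rV[R]_n) (Omega : set 'rV[R]_n).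
Implicit Types (h r e t B C M : R) (i j : 'I_n).

(** With [t] the height over the tangent plane, the barrier is [t] plus a multiple
    of the square norm, large enough for the sum to be positive on the paraboloid,
    minus a multiple of [t ^+ 2], large enough for superharmonicity; near the
    boundary point the last term is dominated by the others. *)
Lemma quadratic_barrier Omega x0 : open Omega -> C2_boundary Omega ->
  boundary Omega x0 -> exists (w : 'rV[R]_n -> R) r B, [/\ 0 < r, 0 <= B,
    forall h x, dlap h w x <= 0 &
    forall x, Omega x -> `|x - x0| < r ->
      `|x - x0| ^+ 2 <= w x <= B * `|x - x0|].
Proof.
move=> oO C2 bx0.
have [a [C [r [a1 C0 r0 aC]]]] := boundary_paraboloid oO C2 bx0.
(* [3 * C] absorbs the depth of the paraboloid below the tangent plane and the
   quadratic term, and [1] gives the lower bound; [K] is the least coefficient for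
   which superharmonicity follows from [1 <= \sum_(i < n) a i ^+ 2]. *)
pose C1 := 3 * C + 1; pose K := n%:R * C1; pose A := \sum_(i < n) `|a i|.
have C10 : 0 <= C1 by rewrite /C1; lra.
have K0 : 0 <= K by rewrite mulr_ge0.
have A0 : 0 <= A by exact: sumr_ge0.
have leA z : `|dotp a z| <= A * `|z|.
  rewrite (le_trans (ler_norm_sum _ _ _))// mulr_suml; apply: ler_sum => i _.
  by rewrite normrM ler_wpM2l// norm_rV_coord.
pose v z := dotp a z + (C1 * sqnorm z + (- K) * dotp a z ^+ 2).
pose rho := Num.min 1 (Num.min r (2 * (K * A + 1))^-1).
have KA0 : 0 <= K * A by rewrite mulr_ge0.
exists (fun x => v (x - x0)), rho, (A + C1 * n%:R); split.
- by rewrite !lt_min ltr01 r0 invr_gt0 mulr_gt0// ltr_wpDl.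
- by rewrite addr_ge0// mulr_ge0.
- move=> h x; rewrite (dlap_shift h v (- x0)) /v dlapD dlap_dotp dlapD !dlapZ.
  rewrite dlap_sqnorm dlap_dotp_sq add0r.
  have -> : C1 * (2 * n%:R * h ^+ 2) = K * (2 * h ^+ 2) by rewrite /K; ring.
  have : 0 <= K * (2 * h ^+ 2) by rewrite mulr_ge0// mulr_ge0// sqr_ge0.
  move=> p0; have := ler_wpM2l p0 a1; lra.
move=> x Ox; rewrite !lt_min => /andP[x1 /andP[xr xK]].
have := aC x Ox xr; have := leA (x - x0); have := le_sqnorm (x - x0).
have := sqnorm_le (lexx `|x - x0|); rewrite /v.
move: (dotp a _) (sqnorm _) => t q.
set s := `|x - x0| in x1 xr xK *; have s0 : 0 <= s by exact: normr_ge0.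
move=> qn qs tA tq; have q0 : 0 <= q by rewrite (le_trans _ qs)// sqr_ge0.
have Kt : K * `|t| <= 2^-1.
  have sK : s * (2 * (K * A + 1)) < 1.
    by rewrite -ltr_pdivlMr ?div1r// mulr_gt0// ltr_wpDl.
  rewrite (le_trans (ler_wpM2l K0 tA))//; lra.
have Ktt : K * t ^+ 2 <= 2^-1 * `|t|.
  by rewrite -[t ^+ 2]real_normK ?num_real// expr2 mulrA ler_wpM2r.
have Ktt0 : 0 <= K * t ^+ 2 by rewrite mulr_ge0 ?sqr_ge0.
have Cq : 0 <= C * q by rewrite mulr_ge0.
apply/andP; split.
  by rewrite (le_trans qs)// /C1; move: Ktt; have [t0|t0] := ger0P t; lra.
have C1q : C1 * q <= C1 * n%:R * s.
  rewrite -mulrA ler_wpM2l// (le_trans qn)// ler_wpM2l//.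
  by rewrite expr2 ler_piMl// ltW.
have := le_trans (ler_norm t) tA; lra.
Qed.

Definition discrete_interior Omega h x : Prop :=
  Omega x /\
  forall i, Omega (x + h *: delta_mx 0 i) /\ Omega (x - h *: delta_mx 0 i).

(** The boundary values of the discrete problem are those of [g] at the points of
    [Omega] with a neighbour outside of [Omega], so [g] is only evaluated in
    [Omega]. *)
Definition discrete_solution Omega (g : 'rV[R]_n -> R) h
    (u : 'rV[R]_n -> R) : Prop :=
  (forall x, discrete_interior Omega h x -> dlap h u x = 0) /\
  (forall x, Omega x -> ~ discrete_interior Omega h x -> u x = g x).

(** Comparison of [u h] with [g x0 + e + K * w], where [w] is the barrier at [x0]
    and [K] is so large that the comparison is trivial away from [x0]. *)
Lemma discrete_boundary_upper Omega (g : 'rV[R]_n -> R) u M x0 e r0 :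
  (0 < n)%N -> open Omega -> C2_boundary Omega -> boundary Omega x0 ->
  (forall h, 0 < h -> discrete_solution Omega g h (u h)) ->
  (forall h x, u h x <= M) -> - M <= g x0 -> 0 < e -> 0 < r0 ->
  (forall x, Omega x -> `|x - x0| < r0 -> g x <= g x0 + e) ->
  exists2 d, 0 < d & forall h x, 0 < h < d -> Omega x -> `|x - x0| < d ->
    u h x <= g x0 + 2 * e.
Proof.
move=> n0 oO C2 bx0 uP uM gM e0 r00 ge.
have [w [r1 [B [r10 B0 lapw wP]]]] := quadratic_barrier oO C2 bx0.
pose r := Num.min r0 r1; have rr : 0 < r by rewrite lt_min r00.
have rr2 : 0 < r / 2 by rewrite divr_gt0.
have M0 : 0 <= `|M| by [].
(* At distance at least [r / 2] from [x0], [K * w] is at least [2 * `|M|], which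
   dominates [u h - g x0]. *)
pose K := 8 * `|M| / r ^+ 2; have K0 : 0 <= K.
  by rewrite divr_ge0 ?sqr_ge0 ?mulr_ge0.
have KB : 0 <= K * B by rewrite mulr_ge0.
exists (Num.min (r / 2) (e / (K * B + 1))).
  by rewrite lt_min rr2 divr_gt0// ltr_wpDl.
move=> h x /andP[h0]; rewrite !lt_min => /andP[hr _] Ox /andP[xr xe].
have [uharm ubd] := uP h h0.
pose f y := u h y - ((g x0 + e) + K * w y).
pose S y := Omega y /\ `|y - x0| < r / 2.
pose F y := if `[< S y >] then Num.max 0 (f y) else 0.
have wr y : Omega y -> `|y - x0| < r -> `|y - x0| ^+ 2 <= w y <= B * `|y - x0|.
  by move=> Oy; rewrite lt_min => /andP[_ yr]; exact: wP.
have Fpos y : 0 < F y -> S y /\ F y = f y.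
  rewrite /F; case: asboolP => [Sy|]; last by rewrite ltxx.
  by rewrite lt_max ltxx/= => fy; split=> //; rewrite max_r// ltW.
have F0 y : 0 <= F y.
  by rewrite /F; case: ifP => // _; rewrite le_max lexx.
have fF y : Omega y -> `|y - x0| < r -> f y <= F y.
  move=> Oy yr; have [Sy|nS] := pselect (S y).
    by rewrite /F asboolT// le_max lexx orbT.
  rewrite (le_trans _ (F0 y))// subr_le0.
  have yr2 : r / 2 <= `|y - x0| by rewrite leNgt; apply/negP => ?; apply: nS.
  have /andP[wy _] := wr y Oy yr.
  have yr3 : (r / 2) ^+ 2 <= w y.
    by rewrite (le_trans _ wy)// lerXn2r ?nnegrE// ltW.
  have := ler_wpM2l K0 yr3; rewrite (_ : K * (r / 2) ^+ 2 = 2 * `|M|); last first.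
    by rewrite /K; field; rewrite gt_eqF.
  have := uM h y; have := ler_norm M; have := ler_norm (- M); rewrite normrN; lra.
have interior y : 0 < F y -> discrete_interior Omega h y.
  move=> /[dup] ltFy /Fpos[[Oy yr2] Ff]; rewrite Ff in ltFy.
  apply: contrapT => /(ubd y Oy) uy.
  have : f y <= 0.
    have yr : `|y - x0| < r by lra.
    have /andP[wy _] := wr y Oy yr; have := le_trans (sqr_ge0 _) wy => wy0.
    have := mulr_ge0 K0 wy0; rewrite /f uy.
    have : g y <= g x0 + e.
      by apply: ge => //; rewrite (lt_le_trans yr)// ge_min lexx.
    lra.
  by move=> fy0; have := lt_le_trans ltFy fy0; rewrite ltxx.
have Fle : forall y, F y <= 0.
  apply: (dlap_max_principle n0 h0).
  - exists (2 * `|M|) => y; rewrite /F; case: asboolP => [[Oy yr2]|_]; last first.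
      by rewrite mulr_ge0.
    rewrite ge_max mulr_ge0//=.
    have yr : `|y - x0| < r by lra.
    have /andP[wy _] := wr y Oy yr; have := le_trans (sqr_ge0 _) wy => wy0.
    have := mulr_ge0 K0 wy0; rewrite /f.
    have := uM h y; have := ler_norm M; have := ler_norm (- M); rewrite normrN; lra.
  - exists (`|x0| + r / 2) => y /Fpos[[_ yr] _].
    by rewrite -[y](subrK x0) (le_trans (ler_normD _ _))// addrC lerD2l ltW.
  move=> y Fy; have [[Oy yr2] Ff] := Fpos _ Fy.
  have [_ nb] := interior _ Fy.
  apply: (@le_trans _ _ (dlap h f y)).
    rewrite /f dlapB uharm; last exact: interior.
    by rewrite sub0r dlapD dlap_cst add0r dlapZ oppr_ge0 mulr_ge0_le0.
  have yh t j : `|t| = h -> `|y + t *: delta_mx 0 j - x0| < r.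
    by move=> th; rewrite addrAC (le_lt_trans (norm_shift_le _ _ _))// th; lra.
  apply: dlap_le => // j; apply: fF; try apply (nb j).
    by apply: yh; rewrite gtr0_norm.
  by rewrite -scaleNr; apply: yh; rewrite normrN gtr0_norm.
have fx := Fle x; have {fx} : f x <= 0.
  by apply: le_trans (fF x Ox _) fx; lra.
have xr' : `|x - x0| < r by lra.
have /andP[_ wB] := wr x Ox xr'; have := ler_wpM2l K0 wB.
move: xe; rewrite ltr_pdivlMr ?ltr_wpDl// /f => xe.
have : 0 <= `|x - x0| by []; lra.
Qed.

Lemma discrete_boundary Omega (g : 'rV[R]_n -> R) u M x0 e r0 :
  (0 < n)%N -> open Omega -> C2_boundary Omega -> boundary Omega x0 ->
  (forall h, 0 < h -> discrete_solution Omega g h (u h)) ->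
  (forall h x, `|u h x| <= M) -> `|g x0| <= M -> 0 < e -> 0 < r0 ->
  (forall x, Omega x -> `|x - x0| < r0 -> `|g x - g x0| <= e) ->
  exists2 d, 0 < d & forall h x, 0 < h < d -> Omega x -> `|x - x0| < d ->
    `|u h x - g x0| <= 2 * e.
Proof.
move=> n0 oO C2 bx0 uP uM gM e0 r00 ge.
have [|||d1 d10 H1] := @discrete_boundary_upper Omega g u M x0 e r0 n0 oO C2 bx0
  uP _ _ e0 r00.
- by move=> h x; rewrite (le_trans (ler_norm _)).
- by move: gM; rewrite ler_norml => /andP[].
- by move=> x Ox xr; have := ge x Ox xr; rewrite ler_norml => /andP[_]; lra.
have [||||d2 d20 H2] := @discrete_boundary_upper Omega (fun x => - g x)
  (fun h x => - u h x) M x0 e r0 n0 oO C2 bx0 _ _ _ e0 r00.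
- move=> h h0; have [u1 u2] := uP h h0; split=> x.
    by move=> Ix; rewrite dlapN u1 ?oppr0.
  by move=> Ox Ix; rewrite u2.
- by move=> h x; rewrite (le_trans (ler_norm _))// normrN.
- by move: gM; rewrite ler_norml lerN2 => /andP[].
- by move=> x Ox xr; have := ge x Ox xr; rewrite ler_norml => /andP[+ _]; lra.
exists (Num.min d1 d2); first by rewrite lt_min d10.
move=> h x; rewrite !lt_min => /and3P[h0 h1 h2] Ox /andP[x1 x2].
have := H1 h x; rewrite h0 h1 => /(_ isT Ox x1).
have := H2 h x; rewrite h0 h2 => /(_ isT Ox x2).
by rewrite ler_norml => ? ?; apply/andP; split; lra.
Qed.

End BoundaryEstimate.

(** * Uniqueness for the Dirichlet problem *)

Section Topology.
Context {R : realType} {n : nat}.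
Implicit Types (x y z : 'rV[R]_n) (A Omega : set 'rV[R]_n).
Implicit Types (f g v w : 'rV[R]_n -> R) (r e s t : R) (i j : 'I_n).

Lemma within_continuousP A f : {within A, continuous f} <->
  (forall x e, A x -> 0 < e -> exists2 r, 0 < r &
     forall y, A y -> `|y - x| < r -> `|f y - f x| <= e).
Proof.
split=> [/subspace_continuousP fA x e Ax e0|fA].
  have /cvgrPdist_le/(_ e e0) := fA x Ax.
  rewrite /within /= => /near_normP[r r0 rf]; exists r => // y Ay yr.
  by rewrite distrC; exact: rf.
apply/subspace_continuousP => x Ax; apply/cvgrPdist_le => e e0.
have [r r0 rf] := fA x e Ax e0.
rewrite /within /=; apply/near_normP; exists r => // y yr Ay.
by rewrite distrC; exact: rf.
Qed.

Lemma closure_normP A x e : closure A x -> 0 < e ->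
  exists2 y, A y & `|y - x| < e.
Proof.
move=> Ax e0; have [|y [Ay yx]] := Ax (fun y => `|y - x| < e).
  by apply/near_normP; exists e.
by exists y.
Qed.

Lemma open_ball Omega x : open Omega -> Omega x ->
  exists2 r, 0 < r & forall y, `|y - x| < r -> Omega y.
Proof. by move=> oO Ox; apply/near_normP; exact: (open_near oO Ox). Qed.

Lemma boundary_open Omega x : open Omega ->
  boundary Omega x <-> closure Omega x /\ ~ Omega x.
Proof. by move=> /interior_id oO; rewrite /boundary oO. Qed.

Lemma closure_bounded Omega : bounded_set Omega ->
  exists2 b, 0 <= b & forall x, closure Omega x -> `|x| <= b.
Proof.
move=> [M [_ /(_ (`|M| + 1))]] Ob; exists (`|M| + 2); first by rewrite addr_ge0.
move=> x /(@closure_normP _ _ 1)/(_ ltr01)[y Oy yx].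
have M1 : M < `|M| + 1 by rewrite (le_lt_trans (ler_norm _))// ltrDl.
have := Ob M1 y Oy; have := ler_normD (x - y) y.
by rewrite subrK distrC /=; lra.
Qed.

Lemma compact_closure_bounded Omega : bounded_set Omega ->
  compact (closure Omega).
Proof.
move=> /closure_bounded[b b0 bO]; apply: bounded_closed_compact.
  exists b; split; first exact: num_real.
  by move=> M bM x /bO /le_trans; apply; exact: ltW.
exact: closed_closure.
Qed.

(** If the second derivative were positive, the first one would increase through
    its value at [x], so that a small step in the direction of its sign would
    increase [f]. *)
Lemma second_partial_le0 f d x i r l : 0 < r ->
  (forall y, `|y - x| < r -> is_derive y (delta_mx 0 i) f (d y)) ->
  is_derive x (delta_mx 0 i) d l ->
  (forall y, `|y - x| < r -> f y <= f x) -> l <= 0.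
Proof.
move=> r0 fd [dd dl] fmax; rewrite leNgt; apply/negP => l0.
have dq : h^-1 *: ((d \o shift x) (h *: delta_mx 0 i) - d x) @[h --> 0^'] --> l.
  by rewrite -dl; exact: dd.
have : \forall h \near 0^', 0 < h^-1 *: ((d \o shift x) (h *: delta_mx 0 i) - d x).
  exact: (cvgr_gt _ dq).
rewrite near_withinE => /nbhs_normP[q /= q0 qP].
have dpos t : t != 0 -> `|t| < q -> 0 < t^-1 * (d (x + t *: delta_mx 0 i) - d x).
  move=> t0 tq; have := qP t; rewrite /ball_/= sub0r normrN => /(_ tq t0).
  by rewrite [_ + x]addrC.
have xt t : `|t| < r -> `|x + t *: delta_mx 0 i - x| < r.
  by move=> tr; rewrite addrAC subrr add0r norm_scale_delta.
(* A step of sign matching the slope at [x] strictly increases [f]. *)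
pose m := Num.min q r / 2.
have m0 : 0 < m by rewrite divr_gt0// lt_min q0.
have [mq mr] : m < q /\ m < r.
  have : Num.min q r <= q /\ Num.min q r <= r by rewrite !ge_min !lexx orbT.
  by rewrite /m; move: m0; rewrite /m; lra.
have [s [s0 sm ds]] : exists s, [/\ s != 0, `|s| = m & 0 <= d x * s].
  have [dx|dx] := leP 0 (d x).
    by exists m; rewrite gt_eqF// gtr0_norm// mulr_ge0// ltW.
  exists (- m); rewrite oppr_eq0 gt_eqF// normrN gtr0_norm//.
  by split=> //; rewrite mulrN oppr_ge0 mulr_le0_ge0// ltW.
have tr t : 0 <= t <= s \/ s <= t <= 0 -> `|t| <= m.
  rewrite -sm => -[/andP[t0 ts]|/andP[st t0]].
    by rewrite !ger0_norm// (le_trans t0).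
  by rewrite !ler0_norm ?lerN2// (le_trans st).
have [|t [ht /(_ s0) t0 E]] := @line_increment _ _ f x (delta_mx 0 i) s.
  move=> t /tr tm; have tr' := le_lt_trans tm mr.
  by have [] := fd _ (xt t tr').
have tm := tr t ht; have tr' := le_lt_trans tm mr.
have fE := fd _ (xt t tr'); rewrite (@derive_val _ _ _ _ _ _ _ fE) in E.
have := dpos t t0 (le_lt_trans tm mq); have sr : `|s| < r by rewrite sm.
have := fmax _ (xt s sr); rewrite -subr_le0 E.
set D := d _ => Ds; case: ht => /andP[].
  rewrite le_eqVlt eq_sym (negPf t0)/= => t_gt0 /(lt_le_trans t_gt0) s_gt0.
  rewrite pmulr_rgt0 ?invr_gt0// subr_gt0.
  by move: ds Ds; rewrite pmulr_lge0// pmulr_lle0//; lra.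
move=> /le_lt_trans st; rewrite le_eqVlt (negPf t0)/= => t_lt0.
have {}s_lt0 := st _ t_lt0; rewrite nmulr_rgt0 ?invr_lt0// subr_lt0.
by move: ds Ds; rewrite nmulr_lge0// nmulr_lle0//; lra.
Qed.

Lemma is_derive_sqnorm x i :
  is_derive x (delta_mx 0 i) (@sqnorm R n) (2 * x 0 i).
Proof.
apply: (@is_derive_of_taylor _ _ _ _ _ _ 1 1) => // t _.
rewrite sqnorm_shift (_ : _ - _ = t ^+ 2); last by ring.
by rewrite mul1r ger0_norm// sqr_ge0.
Qed.

Lemma is_derive_coord x i :
  is_derive x (delta_mx 0 i) (fun y : 'rV[R]_n => y 0 i) 1.
Proof.
apply: (@is_derive_of_taylor _ _ _ _ _ _ 1 0) => // t _.
by rewrite shiftE eqxx (addrC (x 0 i)) addrK subrr normr0 mul0r.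
Qed.

Lemma sqnorm_continuous : continuous (@sqnorm R n).
Proof.
move=> x; apply: (@cvg_fin_sum _ _ _ (nbhs x) _) => i _.
have xi : y 0 i @[y --> x] --> x 0 i by exact: coord_continuous.
exact: (@cvgM _ _ (nbhs x) _ _ _ _ _ xi xi).
Qed.

(** Adding [e * sqnorm] makes the difference of two harmonic functions strictly
    subharmonic, so that it has no interior maximum. *)
Lemma dirichlet_le Omega g v w : (0 < n)%N -> open Omega ->
  bounded_set Omega ->
  dirichlet_solution Omega g v -> dirichlet_solution Omega g w ->
  forall x, closure Omega x -> v x <= w x.
Proof.
move=> n0 oO bO [vC2 vc vlap vg] [wC2 wc wlap wg] x0 clx0.
have [b b0 clb] := closure_bounded bO.
have P0 : 0 <= n%:R * b ^+ 2 by rewrite mulr_ge0// sqr_ge0.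
rewrite -subr_le0; apply/ler_addgt0Pr => e' e'0; rewrite add0r.
pose e := e' / (n%:R * b ^+ 2 + 1).
have e0 : 0 < e by rewrite divr_gt0// ltr_wpDl.
have eb : e * (n%:R * b ^+ 2) <= e'.
  by rewrite /e mulrAC ler_pdivrMr ?ltr_wpDl// ler_pM2l//; lra.
pose f x := v x - w x + e * sqnorm x.
have fc : {within closure Omega, continuous f}.
  apply/subspace_continuousP => x Ox.
  move/subspace_continuousP/(_ x Ox) : (vc) => vx.
  move/subspace_continuousP/(_ x Ox) : (wc) => wx.
  apply: cvgD; first exact: cvgB.
  apply: cvgMl_tmp; apply: cvg_within_filter.
  exact: sqnorm_continuous.
have [c clc fmax] :=
  EVT_max_rV (ex_intro _ x0 clx0) (compact_closure_bounded bO) fc.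
rewrite inE in clc.
have sum_contra (F G : 'I_n -> R) k : 0 < k -> \sum_(i < n) F i = 0 ->
    \sum_(i < n) G i = 0 -> (forall i, F i - G i + k <= 0) -> False.
  move=> k0 F0 G0 FGk; have : \sum_(i < n) (F i - G i + k) <= 0.
    by apply: sumr_le0.
  rewrite big_split sumrB /= F0 G0 subr0 add0r sumr_const card_ord -(mulr_natl k).
  by rewrite leNgt mulr_gt0// ltr0n.
have nOc : ~ Omega c.
  move=> Oc; have [r r0 rO] := open_ball oO Oc.
  have : forall i, partial i (partial i v) c - partial i (partial i w) c + e * 2 <= 0.
    move=> i; pose d y := partial i v y - partial i w y + e * (2 * y 0 i).
    apply: (@second_partial_le0 f d c i r) => //.
    - move=> y /rO Oy; rewrite /f /d.
      have dv : is_derive y (delta_mx 0 i) v (partial i v y).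
        by apply: derivableP; exact: (vC2.2 i).1.
      have dw : is_derive y (delta_mx 0 i) w (partial i w y).
        by apply: derivableP; exact: (wC2.2 i).1.
      have ds := is_derive_sqnorm y i.
      exact: (is_deriveD (is_deriveB dv dw) (is_deriveZ e ds)).
    - rewrite /d.
      have dv : is_derive c (delta_mx 0 i) (partial i v) (partial i (partial i v) c).
        by apply: derivableP; exact: ((vC2.2 i).2.2 i).1.
      have dw : is_derive c (delta_mx 0 i) (partial i w) (partial i (partial i w) c).
        by apply: derivableP; exact: ((wC2.2 i).2.2 i).1.
      have ds := is_deriveZ 2 (is_derive_coord c i).
      rewrite -[e * 2 in X in is_derive _ _ _ X](_ : e *: (2 *: 1) = _); last first.
        by rewrite /GRing.scale/= mulr1.
      exact: (is_deriveD (is_deriveB dv dw) (is_deriveZ e ds)).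
    - move=> y /rO Oy; apply: fmax; rewrite inE; exact: subset_closure.
  by apply: (sum_contra _ _ _ _ (vlap c Oc) (wlap c Oc)); rewrite mulr_gt0.
have bc : boundary Omega c by apply/boundary_open.
have fx0 : f x0 <= f c by apply: fmax; rewrite inE.
have fc0 : f c <= e'.
  rewrite /f vg// wg// subrr add0r (le_trans _ eb)// ler_pM2l//.
  by apply: sqnorm_le; exact: clb.
have : v x0 - w x0 <= f x0 by rewrite lerDl mulr_ge0 ?sqnorm_ge0// ltW.
lra.
Qed.

Lemma dirichlet_unique Omega g v w : (0 < n)%N -> open Omega ->
  bounded_set Omega ->
  dirichlet_solution Omega g v -> dirichlet_solution Omega g w ->
  {in closure Omega, w =1 v}.
Proof.
move=> n0 oO bO vd wd x; rewrite inE => clx.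
by apply/le_anti; rewrite (dirichlet_le n0 oO bO vd wd clx)
  (dirichlet_le n0 oO bO wd vd clx).
Qed.

End Topology.

(** * The Navier problem reduces to the Dirichlet problem *)

Section Navier.
Context {R : realType} {n : nat}.
Implicit Types (x y z : 'rV[R]_n) (Omega : set 'rV[R]_n).
Implicit Types (f g u v w : 'rV[R]_n -> R) (r e s t : R) (i j : 'I_n).

(** [b] is the first point of the half line outside of [Omega]. *)
Lemma exit_point Omega x i : open Omega -> bounded_set Omega -> Omega x ->
  exists2 b, boundary Omega b & forall r, 0 < r -> exists s,
    [/\ 0 <= s, `|x + s *: delta_mx 0 i - b| < r &
        forall t, 0 <= t <= s -> Omega (x + t *: delta_mx 0 i)].
Proof.
move=> oO bO Ox; have [b0 b00 clb] := closure_bounded bO.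
pose T := [set s : R | 0 <= s /\
  forall t, 0 <= t <= s -> Omega (x + t *: delta_mx 0 i)].
have T0 : T 0.
  split=> // t t0; suff -> : t = 0 by rewrite scale0r addr0.
  by apply/le_anti; rewrite andbC.
have supT : has_sup T.
  split; first by exists 0.
  exists (b0 + `|x|) => s [s0 sO].
  have := clb _ (subset_closure (sO s _)); rewrite s0 lexx => /(_ isT) xs.
  have := ler_normB (x + s *: delta_mx 0 i) x.
  by rewrite addrAC subrr add0r norm_scale_delta (ger0_norm s0); lra.
pose c := sup T.
have c0 : 0 <= c by apply: ub_le_sup => //; exact: supT.2.
have dist s : x + s *: delta_mx 0 i - (x + c *: delta_mx 0 i)
    = (s - c) *: delta_mx 0 i.
  by rewrite opprD addrACA subrr add0r scalerBl.
have adh r : 0 < r -> exists s, [/\ T s, c - r < s & s <= c].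
  move=> r0; have [s Ts cs] := sup_adherent r0 supT; exists s; split=> //.
  by apply: ub_le_sup => //; exact: supT.2.
have adh' r : 0 < r -> exists s, [/\ 0 <= s,
    `|x + s *: delta_mx 0 i - (x + c *: delta_mx 0 i)| < r &
    forall t, 0 <= t <= s -> Omega (x + t *: delta_mx 0 i)].
  move=> r0; have [s [[s0 sO] cs sc]] := adh r r0; exists s; split=> //.
  by rewrite dist norm_scale_delta ltr_norml; apply/andP; split; lra.
exists (x + c *: delta_mx 0 i) => //; apply/boundary_open => //; split.
  move=> B /near_normP[r r0 rB]; have [s [s0 sr sO]] := adh' r r0.
  exists (x + s *: delta_mx 0 i); split; last exact: rB.
  by apply: sO; rewrite s0 lexx.
move=> Oc; have [r r0 rO] := open_ball oO Oc.
have [s [[s0 sO] cs sc]] := adh r r0.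
suff : T (c + r / 2).
  by move=> /(ub_le_sup supT.2); rewrite -/c; lra.
split; first by lra.
move=> t /andP[t0 tc]; have [ts|ts] := leP t s; first by apply: sO; rewrite t0.
by apply: rO; rewrite dist norm_scale_delta ltr_norml; apply/andP; split; lra.
Qed.

Lemma partial_laplacian Omega v x i : Ck 3 Omega v -> Omega x ->
  is_derive x (delta_mx 0 i) (laplacian v) (partial i (laplacian v) x).
Proof.
move=> [_ vC] Ox; apply: derivableP.
have -> : laplacian v = \sum_(j < n) partial j (partial j v).
  by apply/funext => y; rewrite fct_sumE.
by apply: derivable_sum => j; exact: (((vC j).2.2 j).2.2 i).1.
Qed.

(** Either [u x] vanishes or the whole gradient does. *)
Lemma gradient_eq0 u x i :
  u x ^+ 3 * euclidean_norm (gradient u x) ^+ 2 = 0 -> u x * partial i u x = 0.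
Proof.
move/eqP; rewrite mulf_eq0 !expf_eq0/= => /orP[/eqP ->|]; first by rewrite mul0r.
rewrite /euclidean_norm sqrtr_eq0 => S0.
suff -> : partial i u x = 0 by rewrite mulr0.
apply/eqP; rewrite -sqrf_eq0 eq_le sqr_ge0 andbT (le_trans _ S0)//.
by rewrite (bigD1 i)//= mxE lerDl; apply: sumr_ge0 => j _; exact: sqr_ge0.
Qed.

(** The square of [u] is constant along the segment issued from [x] up to its
    first exit from [Omega], where [w] vanishes. *)
Lemma eq0_of_square_derive Omega u w i : open Omega -> bounded_set Omega ->
  (forall x, Omega x -> is_derive x (delta_mx 0 i) (fun y => u y * u y) 0) ->
  {within closure Omega, continuous w} -> (forall x, Omega x -> w x = u x) ->
  (forall x, boundary Omega x -> w x = 0) -> forall x, Omega x -> u x = 0.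
Proof.
move=> oO bO du wc wu w0 x Ox; apply/eqP; apply: contraT => ux.
have [b bb bP] := exit_point i oO bO Ox.
have [clb _] := (boundary_open b oO).1 bb.
have ux0 : 0 < `|u x| / 2 by rewrite divr_gt0// normr_gt0.
have [r r0 rw] := (within_continuousP _ _).1 wc b _ clb ux0.
have [s [s0 sr sO]] := bP r r0.
have tO t : 0 <= t <= s \/ s <= t <= 0 -> Omega (x + t *: delta_mx 0 i).
  by move=> ht; apply: sO; case: ht => // /andP[? ?]; lra.
have [t /tO ht|t [/tO Ot _]] :=
    @line_increment _ _ (fun z => u z * u z) x (delta_mx 0 i) s.
  by apply: @ex_derive; exact: du.
rewrite (@derive_val _ _ _ _ _ _ _ (du _ Ot)) mul0r => /subr0_eq uE.
have Os : Omega (x + s *: delta_mx 0 i) by apply: sO; rewrite s0 lexx.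
have := rw _ (subset_closure Os) sr; rewrite (w0 b bb) subr0 (wu _ Os).
suff -> : `|u (x + s *: delta_mx 0 i)| = `|u x| by lra.
by apply/eqP; rewrite -(@eqrXn2 _ 2)//; apply/eqP;
   rewrite !real_normK ?num_real// !expr2.
Qed.

(** The equation makes all partial derivatives of [laplacian v ^+ 2] vanish. *)
Lemma navier_laplacian_eq0 Omega g v x : (0 < n)%N -> open Omega ->
  bounded_set Omega -> navier_solution Omega g v -> Omega x ->
  laplacian v x = 0.
Proof.
move=> n0 oO bO [vC vc veq vg [w [wc wv w0]]].
pose i := Ordinal n0; apply: (eq0_of_square_derive (i := i) oO bO _ wc _ w0).
  move=> y Oy; have D := partial_laplacian i vC Oy.
  have u0 := gradient_eq0 i (veq y Oy).
  apply: is_derive_eq (is_deriveM D D) _.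
  by rewrite /GRing.scale /= u0 addr0.
by move=> y Oy; apply: wv; rewrite inE.
Qed.

Lemma Ck_le k l Omega f : (k <= l)%N -> Ck l Omega f -> Ck k Omega f.
Proof.
elim: k l f => [|k IH] [|l] f //; first by move=> _ [].
by rewrite ltnS => kl [fc fd]; split=> // i; have [? /(IH _ _ kl)] := fd i.
Qed.

Lemma navier_dirichlet Omega g v : (0 < n)%N -> open Omega ->
  bounded_set Omega -> navier_solution Omega g v -> dirichlet_solution Omega g v.
Proof.
move=> n0 oO bO vN; have [vC vc _ vg _] := vN; split=> //; first exact: Ck_le vC.
by move=> x; exact: navier_laplacian_eq0 vN.
Qed.

Lemma dirichlet_navier Omega g v : Ck 3 Omega v ->
  dirichlet_solution Omega g v -> navier_solution Omega g v.
Proof.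
move=> vC [_ vc vlap vg]; split=> //.
  by move=> x Ox; rewrite vlap// expr0n mul0r.
exists (fun=> 0); split=> //; first by move=> x; exact: cvg_cst.
by move=> x; rewrite inE => /vlap ->.
Qed.

End Navier.

(** * Existence for the Dirichlet problem *)

Section Existence.
Context {R : realType} {n : nat}.
Implicit Types (x y z : 'rV[R]_n) (Omega : set 'rV[R]_n).
Implicit Types (f g v w : 'rV[R]_n -> R) (r e s t h M : R) (i j : 'I_n).

Lemma continuous_closure_bounded Omega g : bounded_set Omega ->
  {within closure Omega, continuous g} ->
  exists2 M, 0 <= M & forall x, closure Omega x -> `|g x| <= M.
Proof.
move=> bO gc.
have [M [_ gM]] := compact_bounded (continuous_compact gc (compact_closure_bounded bO)).
exists (`|M| + 1); first by rewrite addr_ge0.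
move=> x clx; apply: (gM (`|M| + 1)); last by exists x.
by rewrite (le_lt_trans (ler_norm _))// ltrDl.
Qed.

Lemma discrete_solution_family Omega g M : (0 < n)%N -> 0 <= M ->
  (forall x, Omega x -> `|g x| <= M) ->
  exists u : R -> 'rV[R]_n -> R, (forall h, discrete_solution Omega g h (u h)) /\
    (forall h x, `|u h x| <= M).
Proof.
move=> n0 M0 gM; pose g' x := if `[< Omega x >] then g x else 0.
have g'M x : `|g' x| <= M.
  by rewrite /g'; case: asboolP => [/gM//|_]; rewrite normr0.
have [u uP] := choice (fun h =>
  discrete_dirichlet h (discrete_interior Omega h) n0 g'M).
exists u; split=> h; last by case: (uP h).
have [_ u0 ug] := uP h; split=> // x Ox Ix.
by rewrite ug// /g' asboolT.
Qed.

Lemma harmonic_family_discrete Omega g u M x : open Omega ->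
  (forall h, discrete_solution Omega g h (u h)) -> (forall h x, `|u h x| <= M) ->
  Omega x -> harmonic_family u x.
Proof.
move=> oO uP uM Ox; have [r r0 rO] := open_ball oO Ox.
exists (r / 2); first by rewrite divr_gt0.
exists M => h y /andP[h0 hr] yr; split; first exact: uM.
have yh t i : `|t| = h -> Omega (y + t *: delta_mx 0 i).
  move=> th; apply: rO.
  by rewrite addrAC (le_lt_trans (norm_shift_le _ _ _))// th; lra.
apply: (uP h).1; split; first by apply: rO; lra.
by move=> i; rewrite -scaleNr; split; apply: yh; rewrite ?normrN gtr0_norm.
Qed.

Theorem dirichlet_exists Omega g : (0 < n)%N -> open Omega ->
  bounded_set Omega -> C2_boundary Omega -> {within closure Omega, continuous g} ->
  exists v, (forall k, Ck k Omega v) /\ dirichlet_solution Omega g v.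
Proof.
move=> n0 oO bO C2 gc; have [M M0 gM] := continuous_closure_bounded bO gc.
have [u [uP uM]] := discrete_solution_family n0 M0
  (fun x Ox => gM x (subset_closure Ox)).
have uO x : Omega x -> harmonic_family u x.
  exact: (harmonic_family_discrete oO uP uM).
have [U [ultraU rightU]] := @ultraFilterLemma _ (0^'+ : set_system R) _.
pose v x := if `[< Omega x >] then ulimit U u x else g x.
have vO x : Omega x -> ulimit U u x = v x by move=> Ox; rewrite /v asboolT.
have vCk k : Ck k Omega v.
  exact: (eq_Ck oO vO (Ck_ulimit ultraU rightU k n0 oO uO)).
have vg x : ~ Omega x -> v x = g x by move=> Ox; rewrite /v asboolF.
exists v; split=> //; split=> //.
- apply/within_continuousP => x e clx e0.
  have [Ox|nOx] := pselect (Omega x).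
    have vx : v y @[y --> x] --> v x := (vCk 0%N).1 x Ox.
    move/cvgrPdist_le/(_ e e0)/near_normP : vx => [r r0 vr].
    by exists r => // y _ yr; rewrite distrC; exact: vr.
  have bx : boundary Omega x by apply/boundary_open.
  have [r0 r00 gr0] := (within_continuousP _ _).1 gc x e clx e0.
  have e20 : 0 < e / 2 by rewrite divr_gt0.
  have [r1 r10 gr1] := (within_continuousP _ _).1 gc x (e / 2) clx e20.
  have [d d0 ud] := discrete_boundary n0 oO C2 bx (fun h _ => uP h) uM
    (gM x clx) e20 r10 (fun y Oy => gr1 y (subset_closure Oy)).
  exists (Num.min r0 (d / 2)); first by rewrite lt_min r00 divr_gt0.
  move=> y cly; rewrite lt_min => /andP[yr0 yd]; rewrite (vg x nOx).
  have [Oy|nOy] := pselect (Omega y); last by rewrite vg// gr0.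
  rewrite -vO//; have [r2 r20 Or2] := open_ball oO Oy.
  pose r := Num.min r2 (d / 2); have rr : 0 < r by rewrite lt_min r20 divr_gt0.
  have ue h z : 0 < h < r -> `|z - y| < r -> g x - e <= u h z <= g x + e.
    rewrite !lt_min => /and3P[h0 _ hd] /andP[zr zd].
    have := ud h z; rewrite h0/=.
    have hd' : h < d by lra.
    have zx : `|z - x| < d.
      by rewrite -(subrKA y) (le_lt_trans (ler_normD _ _))//; lra.
    move=> /(_ hd' (Or2 z zr) zx); rewrite ler_norml => /andP[? ?].
    by apply/andP; split; lra.
  have lo : g x - e <= ulimit U u y.
    by apply: (ulimit_ge ultraU rightU rr _ (uO y Oy)) => h z hr zr;
       case/andP: (ue h z hr zr).
  have hi : ulimit U u y <= g x + e.
    by apply: (ulimit_le ultraU rightU rr _ (uO y Oy)) => h z hr zr;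
       case/andP: (ue h z hr zr).
  by rewrite ler_norml; apply/andP; split; lra.
- move=> x Ox; rewrite -(laplacian_ulimit ultraU rightU n0 oO uO Ox).
  apply: eq_bigr => i _; apply: (eq_partial i oO _ Ox) => y Oy.
  by apply: (eq_partial i oO _ Oy) => z /vO.
- by move=> x /(boundary_open x oO)[_ nOx]; exact: vg.
Qed.

End Existence.

Unset Implicit Arguments.

Theorem theorem1p3 (R : realType) (n : nat) (n_gt0 : (0 < n)%N)
    (Omega : set 'rV[R]_n) (g : 'rV[R]_n -> R)
    (Omega_domain : domain Omega)
    (Omega_bounded : bounded_set Omega)
    (Omega_C2 : C2_boundary Omega)
    (g_continuous : {within closure Omega, continuous g}) :
  exists v : 'rV[R]_n -> R,
    [/\ navier_solution Omega g v,
        forall w, navier_solution Omega g w -> {in closure Omega, w =1 v},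
        dirichlet_solution Omega g v &
        forall w, dirichlet_solution Omega g w -> {in closure Omega, w =1 v}].
Proof.
have [oO _ _] := Omega_domain.
have [v [vCk vD]] := dirichlet_exists n_gt0 oO Omega_bounded Omega_C2 g_continuous.
have unique w : dirichlet_solution Omega g w -> {in closure Omega, w =1 v}.
  exact: (dirichlet_unique n_gt0 oO Omega_bounded vD).
exists v; split=> //; first exact: dirichlet_navier (vCk 3%N) vD.
by move=> w wN; apply: unique; exact: navier_dirichlet wN.
Qed.
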